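(* The relation between unconditional basic sequences ''$(x_i)$ is permutatively equivalent with a subsequence of $(y_i)$'' is a complete analytic quasiorder: it is an analytic quasiorder and every analytic quasiorder on a standard Borel space Borel reduces to it.
   Context: The standard Borel space of unconditional basic sequences is the set of subsequences $(u_n)_{n\in N}$, $N\in[\omega]^\omega$, of Pełczyński's universal unconditional basic sequence. Basic sequences $(x_i),(y_i)$ are equivalent if $\sum a_ix_i$ converges iff $\sum a_iy_i$ converges; $(x_i)$ is permutatively equivalent with a subsequence of $(y_i)$ if there is an injection $f:\mathbb N\to\mathbb N$ with $(x_i)$ equivalent to $(y_{f(i)})$. A quasiorder $R$ Borel reduces to $Q$ if there is a Borel $f$ with $xRy\iff f(x)Qf(y)$. *)

(* Defs.v *)
From HB Require Import structures.
From mathcomp Require Import all_boot all_order all_algebra.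
From mathcomp Require Import all_classical all_reals all_analysis.
Set Implicit Arguments. Unset Strict Implicit. Unset Printing Implicit Defensive.
Import Order.TTheory GRing.Theory Num.Theory.
Import numFieldNormedType.Exports.
Local Open Scope classical_set_scope.
Local Open Scope ring_scope.

Definition sum_converges {R : realType} {V : normedModType R}
  (a : nat -> R) (x : nat -> V) : Prop :=
  cvg (series (fun i => a i *: x i) @ \oo).

Definition closed_span {R : realType} {V : normedModType R} (x : nat -> V) : set V :=
  closure [set y | exists (n : nat) (a : nat -> R), y = \sum_(i < n) a i *: x i].

Definition basic_seq {R : realType} {V : normedModType R} (x : nat -> V) : Prop :=
  forall y, closed_span x y ->
    exists! a : nat -> R, series (fun i => a i *: x i) @ \oo --> y.

Definition uncond_basic_seq {R : realType} {V : normedModType R} (x : nat -> V) : Prop :=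
  basic_seq x /\
  forall a : nat -> R, sum_converges a x ->
    forall s : nat -> nat, bijective s ->
      sum_converges (a \o s) (x \o s).

Definition seq_equiv {R : realType} {V W : normedModType R}
  (x : nat -> V) (y : nat -> W) : Prop :=
  forall a : nat -> R, sum_converges a x <-> sum_converges a y.

Definition perm_equiv_sub {R : realType} {V W : normedModType R}
  (x : nat -> V) (y : nat -> W) : Prop :=
  exists f : nat -> nat, injective f /\ seq_equiv x (y \o f).

Definition inf_subset_nat (N : nat -> bool) : Prop :=
  forall n : nat, exists m : nat, (n <= m)%N /\ N m.

(* increasing enumeration of N: the n-th element of N (counting from 0) *)
Definition enum_inc (N : nat -> bool) (n : nat) : nat :=
  xget 0%N [set m | N m /\ count N (iota 0 m) = n].

Definition subseq_at {T : Type} (y : nat -> T) (N : nat -> bool) : nat -> T :=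
  y \o enum_inc N.

Definition is_sigma_algebra {T : Type} (M : set (set T)) : Prop :=
  M set0 /\ (forall A, M A -> M (~` A)) /\
  (forall F : nat -> set T, (forall n, M (F n)) -> M (\bigcup_n F n)).

Definition gen_sigma {T : Type} (G : set (set T)) : set (set T) :=
  fun A => forall M : set (set T), is_sigma_algebra M -> G `<=` M -> M A.

(* Borel sets of Cantor space 2^N (product topology): generated by the
   subbasic clopen cylinders {x | x n = b} *)
Definition BorelC : set (set (nat -> bool)) :=
  gen_sigma [set A | exists (n : nat) (b : bool), A = [set x | x n = b]].

Definition BorelN : set (set (nat -> nat)) :=
  gen_sigma [set A | exists n k : nat, A = [set x | x n = k]].

Definition prod_sigma {X Y : Type} (MX : set (set X)) (MY : set (set Y))
  : set (set (X * Y)) :=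
  gen_sigma [set C | exists A B, MX A /\ MY B /\ C = A `*` B].

Definition measurable_map {X Y : Type} (MX : set (set X)) (MY : set (set Y))
  (f : X -> Y) : Prop :=
  forall B, MY B -> MX (f @^-1` B).

(* (X, MX) is a standard Borel space: Borel isomorphic to a Borel subset
   of Cantor space (equivalently, to a Polish space with its Borel sets). *)
Definition standard_borel {X : Type} (MX : set (set X)) : Prop :=
  is_sigma_algebra MX /\
  exists f : X -> (nat -> bool),
    injective f /\ BorelC (range f) /\
    forall A, MX A <-> exists B, BorelC B /\ A = f @^-1` B.

Definition analytic_set {X : Type} (MX : set (set X)) (A : set X) : Prop :=
  exists B : set (X * (nat -> nat)),
    prod_sigma MX BorelN B /\ A = fst @` B.

Definition quasiorder_on {X : Type} (D : set X) (P : X -> X -> Prop) : Prop :=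
  (forall x, D x -> P x x) /\
  (forall x y z, D x -> D y -> D z -> P x y -> P y z -> P x z).

Definition rel_set {X : Type} (P : X -> X -> Prop) : set (X * X) :=
  [set p | P p.1 p.2].

Definition perm_sub_rel {R : realType} {U : normedModType R} (u : nat -> U)
  (N M : nat -> bool) : Prop :=
  inf_subset_nat N /\ inf_subset_nat M /\
  perm_equiv_sub (subseq_at u N) (subseq_at u M).

(* Main.v *)
Require Import Defs.
From HB Require Import structures.
From mathcomp Require Import all_boot all_order all_algebra.
From mathcomp Require Import all_classical all_reals all_analysis.
From mathcomp Require Import zify ring lra.
Set Implicit Arguments. Unset Strict Implicit. Unset Printing Implicit Defensive.
Import Order.TTheory GRing.Theory Num.Theory.
Import numFieldNormedType.Exports.
Local Open Scope classical_set_scope.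
Local Open Scope ring_scope.

(* A Baire category argument gives the basic sequence u a suppression constant,
   so convergence of the series along u is insensitive to injective
   reindexing, whence transitivity; a gliding hump then shows that equivalence
   of two subsequences means domination in both directions by one constant,
   a condition on finitely many terms at a time, whence analyticity.

   For completeness, write an analytic quasiorder P on 2^N as the projection of
   a closed set and let S(k, u, v, s) say that u, v, s, cut at length k, are
   approximated by a finite chain of witnesses whose sum is s. Then S is
   transitive with addition of the third argument, and by compactness x P y as
   soon as some alpha satisfies S(k, x, y, alpha) for all k. Let T_y be the tree
   of all nodes (u, s) of length k with S(k, u, y, s).

   Give each node (u, s) infinitely many basis vectors, normed so that they
   have fundamental function n^q with q in (0, 1) determined by u, vectors on a
   branch behave like l_1, and vectors on an antichain like c_0. If alpha
   witnesses x P y, the shift (u, s) -> (u, s + alpha) preserves this norm and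
   maps T_x into T_y. Conversely, an embedding of the basis over T_x into the
   basis over T_y cannot change the labels u, by comparison of fundamental
   functions, and cannot send the branch (x, 0) to an antichain; by Ramsey it
   sends an infinite part of it to a branch (x, alpha) of T_y, so x P y.
   All these bases are subsequences of a single one, hence, by universality, of
   u, which makes the reduction Borel. *)

(** * The Banach space of bounded functions *)

Section Linf.
Variables (R : realType) (I : Type).

Definition linf_pred : {pred I -> R} :=
  fun f => `[< exists M, forall i, `|f i| <= M >].

Record linf := Linf { linf_fun :> I -> R; linf_funP : linf_fun \in linf_pred }.

HB.instance Definition _ := [isSub for linf_fun].
HB.instance Definition _ := gen_eqMixin linf.
HB.instance Definition _ := gen_choiceMixin linf.

Lemma linf_submod_closed : submod_closed linf_pred.
Proof.
split; first by apply/asboolP; exists 0 => i; rewrite normr0.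
move=> a f g /asboolP[M Mf] /asboolP[N Ng]; apply/asboolP.
exists (`|a| * M + N) => i; apply: (le_trans (ler_normD _ _)).
by rewrite lerD// normrM ler_wpM2l.
Qed.

HB.instance Definition _ := GRing.isSubmodClosed.Build _ _ linf_pred linf_submod_closed.
HB.instance Definition _ := [SubChoice_isSubLmodule of linf by <:].

Lemma linfDE (f g : linf) i : (f + g) i = f i + g i. Proof. by []. Qed.
Lemma linfZE a (f : linf) i : (a *: f) i = a * f i. Proof. by []. Qed.
Lemma linf_sumE T (r : seq T) (P : pred T) (F : T -> linf) i :
  (\sum_(j <- r | P j) F j) i = \sum_(j <- r | P j) F j i.
Proof. by elim/big_rec2: _ => // j x y _ <-. Qed.

(** The element 0 makes the set nonempty even for empty [I], so [sup] is a genuine supremum. *)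
Definition linf_norm (f : linf) : R := sup [set r | r = 0 \/ exists i, r = `|f i|].

Lemma linf_norm_has_sup (f : linf) : has_sup [set r | r = 0 \/ exists i, r = `|f i|].
Proof.
split; first by exists 0; left.
have /asboolP[M Mf] := linf_funP f.
by exists (Num.max M 0) => _ [->|[i ->]]; rewrite le_max ?lexx ?orbT ?Mf.
Qed.

Lemma linf_norm_ge0 f : 0 <= linf_norm f.
Proof. by apply: (sup_upper_bound (linf_norm_has_sup f)); left. Qed.

Lemma linf_norm_ub (f : linf) i : `|f i| <= linf_norm f.
Proof. by apply: (sup_upper_bound (linf_norm_has_sup f)); right; exists i. Qed.

Lemma linf_norm_le (f : linf) M : 0 <= M -> (forall i, `|f i| <= M) -> linf_norm f <= M.
Proof.
move=> M0 fM; apply: ge_sup; first by exists 0; left.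
by move=> _ [->//|[i ->]].
Qed.

Lemma linf_normD f g : linf_norm (f + g) <= linf_norm f + linf_norm g.
Proof.
apply: linf_norm_le => [|i]; first by rewrite addr_ge0 ?linf_norm_ge0.
by rewrite linfDE (le_trans (ler_normD _ _))// lerD ?linf_norm_ub.
Qed.

Lemma linf_normZ a f : linf_norm (a *: f) = `|a| * linf_norm f.
Proof.
have le b g : linf_norm (b *: g) <= `|b| * linf_norm g.
  apply: linf_norm_le => [|i]; first by rewrite mulr_ge0 ?linf_norm_ge0.
  by rewrite linfZE normrM ler_wpM2l ?linf_norm_ub.
apply/eqP; rewrite eq_le le/=.
have [->|a0] := eqVneq a 0; first by rewrite normr0 mul0r linf_norm_ge0.
have := le a^-1 (a *: f).
rewrite scalerA mulVf// scale1r normfV mulrC ler_pdivlMr ?normr_gt0//.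
by rewrite mulrC.
Qed.

Lemma linf_norm_eq0 f : linf_norm f = 0 -> f = 0.
Proof.
move=> f0; apply/val_inj/funext => i /=.
by apply/eqP; rewrite -normr_le0 -f0 linf_norm_ub.
Qed.

HB.instance Definition _ := Lmodule_isNormed.Build R linf
  linf_normD linf_normZ linf_norm_eq0.


(** The limit is taken pointwise; a Cauchy estimate uniform in [i] survives it, which gives both
    boundedness of the limit and convergence in norm. *)
Lemma linf_complete (F : set_system linf) : ProperFilter F -> cauchy F -> cvg F.
Proof.
move=> FF Fc.
have cF e : 0 < e -> exists2 A, F A & forall f g, A f -> A g -> `|f - g| <= e.
  move=> e0; have e20 : 0 < e / 2 by rewrite divr_gt0.
  have [x Fx] := (@cauchyP R linf F _).1 Fc _ e20.
  exists (ball x (e / 2)) => // f g xf xg.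
  rewrite -ball_normE/= in xf xg.
  by rewrite -(subrKA x) (le_trans (ler_normD _ _))// (splitr e) lerD ?ltW// distrC.
have cvi i : cvg ((fun f : linf => f i) @ F).
  apply/cauchy_cvgP/cauchy_ballP => e e0.
  have e20 : 0 < e / 2 by rewrite divr_gt0.
  have [A FA Ae] := cF _ e20.
  pose B := (fun f : linf => f i) @` A.
  have FB : F ((fun f : linf => f i) @^-1` B) by apply: filterS FA => f Af; exists f.
  exists (B, B); first by split; exact: FB.
  move=> [_ _] /= [[f Af <-] [g Ag <-]]; rewrite /ball/=.
  apply: (le_lt_trans _ (_ : e / 2 < e)); last by rewrite ltr_pdivrMr// ltr_pMr// ltr1n.
  by apply: (le_trans (linf_norm_ub (f - g) i)); exact: Ae.
pose h i := lim ((fun f : linf => f i) @ F).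
have hle A e : F A -> (forall f g, A f -> A g -> `|f - g| <= e) ->
    forall f, A f -> forall i, `|f i - h i| <= e.
  move=> FA Ae f Af i.
  have : (fun g : linf => `|f i - g i|) @ F --> `|f i - h i|.
    by apply: cvg_norm; apply: cvgB; [exact: cvg_cst|exact: cvi].
  move=> cv; apply: (@closed_cvg _ _ F _ _ (fun r : R => r <= e) (@closed_le R e) _ _ cv).
  by apply: filterS FA => g Ag; apply: le_trans (Ae _ _ Af Ag); exact: (linf_norm_ub (f - g) i).
have hP : h \in linf_pred.
  have [A FA Ae] := cF _ ltr01.
  have [f Af] := filter_ex FA.
  apply/asboolP; exists (`|f| + 1) => i.
  rewrite -(subKr (f i) (h i)) (le_trans (ler_normB _ _))// lerD ?linf_norm_ub//.
  exact: (hle A 1).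
apply/cvg_ex; exists (Linf hP); apply/cvgrPdist_le => e e0.
have [A FA Ae] := cF _ e0.
apply: filterS (FA) => f Af; rewrite distrC; apply: linf_norm_le => [|i]; first exact: ltW.
exact: (hle A e FA Ae f Af i).
Qed.

HB.instance Definition _ := Uniform_isComplete.Build linf linf_complete.

End Linf.

(** * Unconditional convergence and suppression constants *)

Definition suppressing {R : realType} {V : normedModType R} (x : nat -> V) (K : R) :=
  0 < K /\ forall (a : nat -> R) (F : seq nat) (P : pred nat), uniq F ->
    `|\sum_(j <- F | P j) a j *: x j| <= K * `|\sum_(j <- F) a j *: x j|.

(** Unlike convergence of partial sums, this criterion ignores the order of the terms, so it can be
    transported along injections. *)
Definition uncond_cauchy {R : realType} {V : normedModType R} (a : nat -> R) (x : nat -> V) :=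
  forall e, 0 < e -> exists n : nat, forall F : seq nat, uniq F -> all (leq n) F ->
    `|\sum_(j <- F) a j *: x j| <= e.

Definition inj_inv (h : nat -> nat) (j : nat) : nat := xget 0%N [set i | h i = j].

Lemma inj_invK (h : nat -> nat) : injective h -> cancel h (inj_inv h).
Proof. by move=> hI i; rewrite /inj_inv; case: xgetP => [k _ /= /hI//|/(_ i)/(_ erefl)]. Qed.

(** Coefficients carried from [i] to [h i], with zeros off the range of [h]. As [inj_inv] has a
    default value there, the test [h (inj_inv h j) == j] decides membership in the range. *)
Definition extend0 {R : realType} (h : nat -> nat) (a : nat -> R) (j : nat) : R :=
  if h (inj_inv h j) == j then a (inj_inv h j) else 0.

Lemma extend0E {R : realType} (h : nat -> nat) (a : nat -> R) i :
  injective h -> extend0 h a (h i) = a i.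
Proof. by move=> hI; rewrite /extend0 inj_invK// eqxx. Qed.

Lemma injective_unbounded (h : nat -> nat) (n : nat) : injective h ->
  exists m, forall i, (m <= i)%N -> (n <= h i)%N.
Proof.
move=> hI; elim: n => [|n [m mP]]; first by exists 0%N.
have [[k hk]|nk] := pselect (exists k, h k = n).
  exists (maxn m k.+1) => i; rewrite geq_max => /andP[mi ki].
  rewrite ltn_neqAle mP// andbT; apply/eqP => /esym; rewrite -hk => /hI ik.
  by rewrite ik ltnn in ki.
exists m => i mi; rewrite ltn_neqAle mP// andbT; apply/eqP => /esym hi.
by apply: nk; exists i.
Qed.

Section Basics.
Variables (R : realType).
Implicit Types (a : nat -> R).

Lemma sum_convergesP (V : completeNormedModType R) a (x : nat -> V) :
  sum_converges a x <-> forall e, 0 < e -> exists N : nat, forall n m : nat, (N <= n)%N ->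
     `|\sum_(n <= i < m) a i *: x i| <= e.
Proof.
rewrite /sum_converges; split=> [cv e e0|H].
  have /cauchy_cvgP/cauchy_seriesP/(_ e e0) := cv.
  move=> [[A B] [[N _ NA] [M _ MB]] AB].
  exists (maxn N M) => n m; rewrite geq_max => /andP[Nn Mn].
  have [nm|mn] := leqP n m; last by rewrite big_geq ?normr0 1?ltW// ltnW.
  by apply/ltW/(AB (n, m)); split; [exact: NA|exact/MB/(leq_trans Mn)].
apply/cauchy_cvgP/cauchy_seriesP => e e0.
have e20 : 0 < e / 2 by rewrite divr_gt0.
have [N NP] := H _ e20.
exists ([set n | (N <= n)%N], [set n | (N <= n)%N]).
  by split; exists N.
move=> [n m] /= [Nn _]; apply: le_lt_trans (NP n m Nn) _.
by rewrite ltr_pdivrMr// ltr_pMr// ltr1n.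
Qed.

Lemma uncond_cauchy_converges (V : completeNormedModType R) a (x : nat -> V) :
  uncond_cauchy a x -> sum_converges a x.
Proof.
move=> uc; apply/sum_convergesP => e /uc[n nP]; exists n => p q np.
apply: nP; first exact: iota_uniq.
by apply/allP => i; rewrite mem_index_iota => /andP[/(leq_trans np)].
Qed.

Lemma suppressing_uncond_cauchy (V : completeNormedModType R) a (x : nat -> V) K :
  suppressing x K -> sum_converges a x -> uncond_cauchy a x.
Proof.
move=> [K0 sK] /sum_convergesP cv e e0.
have [N NP] := cv (e / K) (divr_gt0 e0 K0).
exists N => F uF /allP NF.
pose m := (\max_(j <- F) j).+1.
have Fm j : j \in F -> (j < m)%N.
  by move=> jF; rewrite ltnS; apply: leq_bigmax_seq.
have -> : \sum_(j <- F) a j *: x j = \sum_(j <- index_iota N m | j \in F) a j *: x j.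
  rewrite -[RHS]big_filter; set G := [seq _ <- _ | _].
  rewrite [LHS](perm_big G)//; apply: uniq_perm => //.
    by rewrite filter_uniq// iota_uniq.
  move=> j; rewrite mem_filter mem_index_iota; case jF : (j \in F) => //=.
  by rewrite Fm// andbT NF.
apply: (le_trans (sK _ _ _ (iota_uniq _ _))).
by rewrite mulrC -ler_pdivlMr// NP.
Qed.

Lemma suppressing_convergesP (V : completeNormedModType R) a (x : nat -> V) K :
  suppressing x K -> sum_converges a x <-> uncond_cauchy a x.
Proof.
by move=> sK; split; [exact: suppressing_uncond_cauchy sK|exact: uncond_cauchy_converges].
Qed.

Lemma extend0_sum (V : lmodType R) a (x : nat -> V) h (F : seq nat) (P : pred nat) :
  injective h ->
  \sum_(i <- F | P i) a i *: x (h i)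
  = \sum_(j <- map h F | P (inj_inv h j)) extend0 h a j *: x j.
Proof.
move=> hI; rewrite big_map; apply: eq_big => i; first by rewrite inj_invK.
by rewrite extend0E.
Qed.

Lemma uncond_cauchy_extend0 (V : normedModType R) a (x : nat -> V) h : injective h ->
  uncond_cauchy a (x \o h) <-> uncond_cauchy (extend0 h a) x.
Proof.
move=> hI; split=> uc e e0; have [n nP] := uc e e0.
  (* From [N] on, no index is the image of one below [n]. *)
  pose N := (\max_(i <- iota 0 n) h i).+1.
  exists N => F uF /allP NF.
  have -> : \sum_(j <- F) extend0 h a j *: x j =
            \sum_(i <- [seq inj_inv h j | j <- F & h (inj_inv h j) == j]) a i *: x (h i).
    rewrite (extend0_sum _ _ _ _ hI)/= -map_comp map_id_in; last first.
      by move=> j; rewrite mem_filter => /andP[/eqP].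
    rewrite big_filter [LHS]big_mkcond [RHS]big_mkcond; apply: eq_bigr => j _.
    by rewrite /extend0; case: ifP; rewrite ?scale0r.
  apply: nP.
    rewrite map_inj_in_uniq ?filter_uniq// => i j.
    by rewrite !mem_filter => /andP[/eqP hi _] /andP[/eqP hj _] ij; rewrite -hi ij hj.
  apply/allP => _ /mapP[j + ->]; rewrite mem_filter => /andP[/eqP hj /NF].
  apply: contraLR; rewrite -!ltnNge => lt; rewrite /N ltnS -[leqLHS]hj.
  by apply: leq_bigmax_seq; rewrite // mem_iota.
have [m mP] := injective_unbounded n hI.
exists m => F uF /allP mF; rewrite (extend0_sum _ _ _ _ hI); apply: nP.
  by rewrite map_inj_uniq.
by apply/allP => _ /mapP[i /mF mi ->]; exact: mP.
Qed.

Lemma suppressing_comp (V : normedModType R) (x : nat -> V) h K : injective h ->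
  suppressing x K -> suppressing (x \o h) K.
Proof.
move=> hI [K0 sK]; split=> // a F P uF.
by rewrite !(extend0_sum _ _ _ _ hI) sK// map_inj_uniq.
Qed.

(** The coefficients along [h] are extended by zero and the equivalence is applied to the extension.
    As [h] may reorder the terms, the suppression constants serve to make the order of summation
    irrelevant. *)
Lemma seq_equiv_comp (V W : completeNormedModType R) (x : nat -> V) (y : nat -> W) K L h :
  injective h -> suppressing x K -> suppressing y L ->
  seq_equiv x y -> seq_equiv (x \o h) (y \o h).
Proof.
move=> hI sx sy xy a.
rewrite (suppressing_convergesP _ (suppressing_comp hI sx)).
rewrite (suppressing_convergesP _ (suppressing_comp hI sy)).
rewrite (uncond_cauchy_extend0 _ x hI) (uncond_cauchy_extend0 _ y hI).
by rewrite -(suppressing_convergesP _ sx) -(suppressing_convergesP _ sy).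
Qed.

Lemma perm_equiv_sub_trans (V1 V2 V3 : completeNormedModType R)
    (x : nat -> V1) (y : nat -> V2) (z : nat -> V3) K L :
  suppressing y K -> suppressing z L ->
  perm_equiv_sub x y -> perm_equiv_sub y z -> perm_equiv_sub x z.
Proof.
move=> sy sz [f [fI xy]] [g [gI yz]]; exists (g \o f); split; first exact: inj_comp.
have := seq_equiv_comp fI sy (suppressing_comp gI sz) yz.
by move=> yz' a; rewrite (xy a) (yz' a).
Qed.

End Basics.

(** Each list enumerates an initial segment and extends the one before, so together they enumerate
    nat. [s i] reads list [i.+1], which is certain to have an entry [i]. *)
Lemma nested_perm_bijective (L : nat -> seq nat) :
  (forall k, prefix (L k) (L k.+1)) ->
  (forall k, perm_eq (L k) (iota 0 (size (L k)))) ->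
  (forall k, (k <= size (L k))%N) ->
  exists2 s : nat -> nat, bijective s &
    forall k i, (i < size (L k))%N -> s i = nth 0%N (L k) i.
Proof.
move=> pL pmL sL; pose s i := nth 0%N (L i.+1) i.
have pLD k m : prefix (L k) (L (k + m)%N).
  elim: m => [|m IH]; first by rewrite addn0 prefix_refl.
  by rewrite addnS (prefix_trans IH).
have nthL k l i : (i < size (L k))%N -> (i < size (L l))%N ->
    nth 0%N (L k) i = nth 0%N (L l) i.
  wlog kl : k l / (k <= l)%N => [H|].
    by case/orP: (leq_total k l) => ? ? ?; [exact: H|apply/esym/H].
  move=> ik _; have /prefixP[t] := pLD k (l - k)%N.
  by rewrite subnKC// => ->; rewrite nth_cat ik.
have sE k i : (i < size (L k))%N -> s i = nth 0%N (L k) i.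
  by move=> ik; apply: nthL.
have uL k : uniq (L k) by rewrite (perm_uniq (pmL k)) iota_uniq.
have sI : injective s.
  move=> i j; rewrite (sE (maxn i j).+1 i) ?(sE (maxn i j).+1 j); last 2 first.
  - by rewrite (leq_trans _ (sL _))// ltnS leq_maxr.
  - by rewrite (leq_trans _ (sL _))// ltnS leq_maxl.
  move/eqP; rewrite nth_uniq ?uL//; first by move/eqP.
  - by rewrite (leq_trans _ (sL _))// ltnS leq_maxl.
  - by rewrite (leq_trans _ (sL _))// ltnS leq_maxr.
pose g j := index j (L j.+1).
have gK : cancel g s.
  move=> j; have jL : j \in L j.+1 by rewrite (perm_mem (pmL _)) mem_iota/= sL.
  by rewrite (sE j.+1) ?index_mem// nth_index.
exists s => //; exists g => // i; exact/sI/gK.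
Qed.

Section Uncond.
Variables (R : realType).
Implicit Types (a : nat -> R).

(* If the series is not unconditionally Cauchy, reorder each of a sequence of
   consecutive intervals so that a finite set with large sum comes first. *)
Lemma rearrangements_uncond_cauchy (V : completeNormedModType R) a (x : nat -> V) :
  (forall s, bijective s -> sum_converges (a \o s) (x \o s)) -> uncond_cauchy a x.
Proof.
move=> cvs; apply: contrapT => /existsNP[e /not_implyP[e0 /forallNP ne]].
have /choice[F FP] : forall n, exists F : seq nat,
    [/\ uniq F, all (leq n) F & e < `|\sum_(j <- F) a j *: x j|].
  move=> n; have /existsNP[F /not_implyP[uF /not_implyP[nF /negP]]] := ne n.
  by rewrite -ltNge => lt; exists F.
(* After [G] come the remaining numbers of an interval that starts at [size L] and is long enough to
   contain [G], so that the list again permutes an initial segment. *)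
pose step (L : seq nat) := let G := F (size L) in
  L ++ (G ++ [seq j <- iota (size L) (\max_(j <- G) j).+1 | j \notin G]).
pose L k := iter k step [::].
have pL k : prefix (L k) (L k.+1) by rewrite /= /step prefix_prefix.
have pmL k : perm_eq (L k) (iota 0 (size (L k))).
  elim: k => [|k IH] //.
  have [uF /allP nF _] := FP (size (L k)).
  rewrite [L k.+1]/(step (L k)) /step; set G := F _; set I := iota _ _.
  have pI : perm_eq (G ++ [seq j <- I | j \notin G]) I.
    apply: uniq_perm; last 1 first.
    - move=> j; rewrite mem_cat mem_filter; case jG : (j \in G) => //=.
      rewrite mem_iota nF//= addnS ltnS; apply/esym.
      by apply: leq_trans (leq_addl _ _); apply: leq_bigmax_seq.
    - rewrite cat_uniq uF filter_uniq ?iota_uniq// andbT.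
      by apply/hasPn => j; rewrite mem_filter => /andP[].
    - exact: iota_uniq.
  rewrite size_cat (perm_size pI) size_iota iotaD.
  by apply: perm_cat.
have sL k : (k <= size (L k))%N.
  elim: k => // k IH; rewrite [L k.+1]/(step (L k)) /step !size_cat.
  have [_ _ lt] := FP (size (L k)).
  suff : (0 < size (F (size (L k))))%N by lia.
  by case: (F _) lt => //; rewrite big_nil normr0 ltNge ltW.
have [s bs sE] := nested_perm_bijective pL pmL sL.
have /sum_convergesP/(_ e e0)[N NP] := cvs s bs.
have := NP (size (L N)) (size (L N) + size (F (size (L N))))%N (sL N).
have [_ _] := FP (size (L N)); set G := F (size (L N)).
suff -> : \sum_(j <- G) a j *: x j =
  \sum_(size (L N) <= i < size (L N) + size G) (a \o s) i *: (x \o s) i.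
  by rewrite ltNge => /negP.
rewrite -(big_map s xpredT (fun j => a j *: x j)); congr (\big[_/_]_(_ <- _) _).
rewrite /index_iota addKn; apply: (@eq_from_nth _ 0%N).
  by rewrite size_map size_iota.
move=> i iG; rewrite (nth_map 0%N) ?size_iota// nth_iota//.
have LE : L N.+1 = L N ++ (G ++ [seq j <- iota (size (L N)) (\max_(j <- G) j).+1 | j \notin G]).
  by [].
rewrite (sE N.+1); last by rewrite LE !size_cat ltn_add2l ltn_addr.
by rewrite LE nth_cat ltnNge leq_addr/= addKn nth_cat iG.
Qed.

(* For integers M these sets cover the closed span, which sets up the Baire argument. *)
Definition uncond_ball {V : normedModType R} (x : nat -> V) (M : R) : set V :=
  [set y | exists a, series (fun i => a i *: x i) @ \oo --> y /\
     forall F : seq nat, uniq F -> `|\sum_(j <- F) a j *: x j| <= M].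

Lemma uncond_ballB (V : normedModType R) (x : nat -> V) M N y z :
  uncond_ball x M y -> uncond_ball x N z -> uncond_ball x (M + N) (y - z).
Proof.
move=> [a [ay aM]] [b [bz bN]]; exists (fun i => a i - b i); split.
  rewrite (_ : (fun i => _) = (fun i => a i *: x i) - (fun i => b i *: x i)); last first.
    by apply/funext => i; rewrite fctE scalerBl.
  by rewrite seriesD seriesN; exact: cvgB.
move=> F uF; under eq_bigr do rewrite scalerBl.
by rewrite sumrB (le_trans (ler_normB _ _))// lerD ?aM ?bN.
Qed.

Lemma uncond_ballZ (V : normedModType R) (x : nat -> V) M y c :
  uncond_ball x M y -> uncond_ball x (`|c| * M) (c *: y).
Proof.
move=> [a [ay aM]]; exists (fun i => c * a i); split.
  rewrite (_ : (fun i => _) = c *: (fun i => a i *: x i)); last first.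
    by apply/funext => i; rewrite fctE scalerA.
  by rewrite seriesZ; exact: cvgZl_tmp.
move=> F uF; under eq_bigr do rewrite -scalerA.
by rewrite -scaler_sumr normrZ ler_wpM2l ?aM.
Qed.

Lemma uncond_ball_union (V : completeNormedModType R) (x : nat -> V) y :
  uncond_basic_seq x -> closed_span x y -> exists n : nat, uncond_ball x n%:R y.
Proof.
move=> [bx ux] /bx[a [ay _]].
have ca : sum_converges a x by apply/cvg_ex; exists y.
have [n nP] := rearrangements_uncond_cauchy (fun s bs => ux a ca s bs) ltr01.
(* Terms below [n] are bounded by the sum of their norms, the rest of any finite set by 1. *)
pose M := \sum_(i < n) `|a i *: x i| + 1.
have M0 : 0 <= M by rewrite addr_ge0// sumr_ge0.
have [m Mm] : exists m : nat, M <= m%:R.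
  by exists (Num.trunc M).+1; rewrite ltW// truncnS_gt.
exists m; exists a; split=> // F uF; apply: le_trans Mm.
rewrite (bigID (fun j => (j < n)%N))/= (le_trans (ler_normD _ _))// lerD//.
  rewrite (le_trans (ler_norm_sum _ _ _))// -big_filter.
  rewrite -(big_mkord xpredT (fun i => `|a i *: x i|)).
  set G := [seq _ <- _ | _].
  rewrite [leRHS](bigID (mem G))/= -[leLHS]addr0 lerD ?sumr_ge0//.
  rewrite -[leRHS]big_filter (perm_big [seq i <- index_iota 0 n | i \in G])//.
  apply: uniq_perm; rewrite ?filter_uniq ?iota_uniq// => i.
  rewrite [RHS]mem_filter mem_index_iota /G mem_filter.
  by case: (i < n)%N; rewrite /= ?andbF ?andbT.
rewrite -big_filter; apply: nP; first by rewrite filter_uniq.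
by apply/allP => j; rewrite mem_filter -leqNgt => /andP[].
Qed.

End Uncond.

(** * Unconditional basic sequences have a suppression constant *)

Section Baire.
Variables (R : realType).

Lemma half_exp_small (C e : R) : 0 <= C -> 0 < e -> exists n : nat, C * 2^-1 ^+ n <= e.
Proof.
move=> C0 e0; have [->|C1] := eqVneq C 0; first by exists 0%N; rewrite mul0r ltW.
have Cp : 0 < C by rewrite lt_def C1.
exists (Num.trunc (C / e)).+1.
rewrite exprVn ler_pdivrMr ?exprn_gt0// mulrC -ler_pdivrMr//.
apply: le_trans (ltW (truncnS_gt _)) _.
by rewrite -natrX ler_nat ltnW// ltn_expl.
Qed.

Lemma geometric_cauchy (V : completeNormedModType R) (z : nat -> V) (C : R) : 0 <= C ->
  (forall n m, (n <= m)%N -> `|z m - z n| <= C * 2^-1 ^+ n) ->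
  exists l : V, (z @ \oo --> l) /\ (forall n, `|l - z n| <= C * 2^-1 ^+ n).
Proof.
move=> C0 zP.
have cz : cvg (z @ \oo).
  apply/cauchy_cvgP/cauchy_exP => e e0.
  have e20 : 0 < e / 2 by rewrite divr_gt0.
  have [N NP] := half_exp_small C0 e20.
  exists (z N); exists N => // n /= Nn; rewrite -ball_normE/= distrC.
  by apply: le_lt_trans (le_trans (zP _ _ Nn) NP) _; lra.
exists (lim (z @ \oo)); split => // n.
have cv : (fun m => `|z m - z n|) @ \oo --> `|lim (z @ \oo) - z n|.
  by apply: cvg_norm; apply: cvgB => //; exact: cvg_cst.
apply: (@closed_cvg _ _ \oo _ _ (fun r : R => r <= C * 2^-1 ^+ n) (@closed_le R _) _ _ cv).
by exists n => // m /= nm; exact: zP.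
Qed.

(** If no [B n] were dense in a ball of [Y], one could choose nested balls centred in [Y], the radii
    at least halving, that avoid the sets [B n] in turn; the limit of the centres would lie in [Y]
    and in no [B n]. *)
Lemma baire_closed (V : completeNormedModType R) (Y : set V) (B : nat -> set V) :
  closed Y -> Y !=set0 -> (forall y, Y y -> exists n, B n y) ->
  exists (n : nat) (y0 : V) (r : R),
    [/\ Y y0, 0 < r & forall y, Y y -> `|y - y0| < r -> closure (B n) y].
Proof.
move=> clY [y00 Yy00] cov; apply: contrapT => nH.
have step n (p : V * R) : exists q : V * R, Y p.1 -> 0 < p.2 ->
    [/\ Y q.1, 0 < q.2, q.2 <= p.2 / 2, `|q.1 - p.1| + q.2 <= p.2 &
     forall z, `|z - q.1| <= q.2 -> ~ B n z].
  have [[Yp p0]|np] := pselect (Y p.1 /\ 0 < p.2); last first.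
    by exists p => ? ?; exfalso; apply: np.
  have [y [Yy yp ncl]] : exists y, [/\ Y y, `|y - p.1| < p.2 & ~ closure (B n) y].
    apply: contrapT => ny; apply: nH; exists n, p.1, p.2; split=> // y Yy yp.
    by apply: contrapT => ncl; apply: ny; exists y.
  have [e [e0 eB]] : exists e : R, 0 < e /\ forall z, `|z - y| < e -> ~ B n z.
    have : ~ forall e : R, 0 < e -> exists z, `|z - y| < e /\ B n z.
      move=> H; apply: ncl => U /nbhs_ballP[e /= e0 eU].
      have [z [zy Bz]] := H e e0; exists z; split=> //; apply: eU.
      by rewrite -ball_normE/= distrC.
    move=> /existsNP[e /not_implyP[e0 nz]]; exists e; split=> // z zy Bz.
    by apply: nz; exists z.
  (* The first bound keeps the closed ball off [B n], the second makes the radii summable, the third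
     keeps the ball inside the previous one. *)
  pose r' := Num.min (e / 2) (Num.min (p.2 / 2) (p.2 - `|y - p.1|)).
  have r'0 : 0 < r' by rewrite !lt_min !divr_gt0// subr_gt0.
  exists (y, r') => _ _; split=> //=.
  - by rewrite !ge_min lexx orbT.
  - have : r' <= p.2 - `|y - p.1| by rewrite !ge_min lexx !orbT.
    by rewrite lerBrDl.
  - move=> z zr; apply: eB; apply: le_lt_trans zr _.
    have : r' <= e / 2 by rewrite !ge_min lexx.
    by move=> /le_lt_trans; apply; rewrite ltr_pdivrMr// ltr_pMr// ltr1n.
have /choice[G GP] : forall n, exists g : V * R -> V * R, forall p, Y p.1 -> 0 < p.2 ->
    [/\ Y (g p).1, 0 < (g p).2, (g p).2 <= p.2 / 2, `|(g p).1 - p.1| + (g p).2 <= p.2 &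
     forall z, `|z - (g p).1| <= (g p).2 -> ~ B n z].
  by move=> n; have /choice[g gP] := step n; exists g.
pose s := fix s n := if n is m.+1 then G m (s m) else (y00, 1).
have sP n : Y (s n).1 /\ 0 < (s n).2.
  by elim: n => //= n [Y1 r1]; have [] := GP n _ Y1 r1.
have s2 n : (s n).2 <= 2^-1 ^+ n.
  elim: n => [|n IH]; first by rewrite expr0.
  have [Y1 r1] := sP n; have [_ _ + _ _] := GP n _ Y1 r1.
  move=> /le_trans; apply; rewrite exprSr ler_pM2r//.
have sd n m : (n <= m)%N -> `|(s m).1 - (s n).1| + (s m).2 <= (s n).2.
  move=> nm; rewrite -(subnK nm); elim: (m - n)%N => [|k IH].
    by rewrite add0n subrr normr0 add0r.
  have [Y1 r1] := sP (k + n)%N; have [_ _ _ + _] := GP (k + n)%N _ Y1 r1.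
  rewrite -[G _ _]/(s (k + n).+1) addSn => h.
  have := ler_distD (s (k + n)%N).1 (s (k + n).+1).1 (s n).1.
  by lra.
have [|l [zl lz]] := @geometric_cauchy V (fun n => (s n).1) 1 ler01.
  move=> n m nm; rewrite mul1r; apply: le_trans (s2 n).
  by apply: le_trans (sd _ _ nm); rewrite lerDl ltW//; case: (sP m).
have ls n : `|l - (s n).1| <= (s n).2.
  have cv : (fun m => `|(s m).1 - (s n).1|) @ \oo --> `|l - (s n).1|.
    by apply: cvg_norm; apply: cvgB => //; exact: cvg_cst.
  apply: (@closed_cvg _ _ \oo _ _ (fun r : R => r <= (s n).2) (@closed_le R _) _ _ cv).
  exists n => // m /= nm; apply: le_trans (sd _ _ nm).
  by rewrite lerDl ltW//; case: (sP m).
have Yl : Y l.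
  apply: (@closed_cvg _ _ \oo _ _ Y clY _ _ zl).
  by exists 0%N => // n _; case: (sP n).
have [n Bn] := cov l Yl.
have [Y1 r1] := sP n; have [_ _ _ _ /(_ l (ls n.+1))] := GP n _ Y1 r1.
exact.
Qed.

End Baire.

(** * An open mapping argument for unconditional expansions *)

Section OpenMapping.
Variables (R : realType) (V : completeNormedModType R) (x : nat -> V).
Hypothesis ubx : uncond_basic_seq x.

Lemma closed_span_series (a : nat -> R) y :
  series (fun i => a i *: x i) @ \oo --> y -> closed_span x y.
Proof.
move=> ay; rewrite /closed_span => U Uy.
have [N _ NU] := ay U Uy.
exists (series (fun i => a i *: x i) N); split; last by apply: NU => /=.
by exists N, a; rewrite /series/= big_mkord.
Qed.

Lemma uncond_ball_closed_span M y : uncond_ball x M y -> closed_span x y.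
Proof. by move=> [a [ay _]]; exact: closed_span_series ay. Qed.

Lemma closed_spanB y z : closed_span x y -> closed_span x z -> closed_span x (y - z).
Proof.
move=> /(uncond_ball_union ubx)[n yn] /(uncond_ball_union ubx)[m zm].
exact: uncond_ball_closed_span (uncond_ballB yn zm).
Qed.

Lemma closed_spanZ c y : closed_span x y -> closed_span x (c *: y).
Proof.
move=> /(uncond_ball_union ubx)[n yn].
exact: uncond_ball_closed_span (uncond_ballZ c yn).
Qed.

Lemma closed_span0 : closed_span x 0.
Proof.
apply: (@closed_span_series (fun=> 0)).
rewrite (_ : series _ = fun=> 0); first exact: cvg_cst.
by apply/funext => n; rewrite /series/= big1// => i _; rewrite scale0r.
Qed.

Lemma closed_spanD y z : closed_span x y -> closed_span x z -> closed_span x (y + z).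
Proof.
move=> Yy Yz; rewrite -[z]opprK; apply: closed_spanB => //.
by rewrite -sub0r; apply: closed_spanB => //; exact: closed_span0.
Qed.

Lemma finite_series (a : nat -> R) (F : seq nat) (P : pred nat) : uniq F ->
  series (fun i => (if (i \in F) && P i then a i else 0) *: x i) @ \oo -->
  \sum_(j <- F | P j) a j *: x j.
Proof.
move=> uF; apply: cvg_near_cst; exists (\max_(j <- F) j).+1 => // n /= Fn.
rewrite /series/= [RHS]big_mkcond/=.
rewrite (eq_bigr (fun i => if i \in F then if P i then a i *: x i else 0 else 0)); last first.
  by move=> i _; case: (i \in F); case: (P i); rewrite /= ?scale0r.
rewrite -big_mkcond -big_filter; set G := [seq _ <- _ | _].
rewrite (perm_big F)//; apply: uniq_perm; rewrite ?filter_uniq ?iota_uniq//.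
move=> i; rewrite mem_filter mem_index_iota; case iF : (i \in F) => //=.
by apply: leq_trans Fn; rewrite ltnS; apply: leq_bigmax_seq.
Qed.

Lemma basic_seq_neq0 i : x i != 0.
Proof.
apply/eqP => xi0; have [bx _] := ubx.
have [a [_ aU]] := bx 0 closed_span0.
have h0 : a = fun=> 0.
  apply: aU; rewrite (_ : series _ = fun=> 0); first exact: cvg_cst.
  by apply/funext => n; rewrite /series/= big1// => j _; rewrite scale0r.
have h1 : a = fun j => if (j \in [:: i]) && xpredT j then 1 else 0.
  apply: aU; have := @finite_series (fun=> 1) [:: i] xpredT isT.
  by rewrite big_seq1 xi0 scaler0.
have := congr1 (fun f => f i) h1; rewrite h0 /= inE eqxx /= => /eqP.
by rewrite eq_sym oner_eq0.
Qed.

(** Baire gives a ball around some [y0] in which one of the sets [uncond_ball x n%:R] is dense;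
    subtracting approximations of [y0 + y] and of [y0] moves this to a ball around 0. *)
Lemma uncond_ball_approx : exists (M r : R), [/\ 0 < M, 0 < r & forall y,
  closed_span x y -> `|y| < r -> forall d, 0 < d ->
  exists y', uncond_ball x M y' /\ `|y - y'| < d].
Proof.
have [n [y0 [r [Y0 r0 H]]]] := @baire_closed R V (closed_span x)
  (fun n => uncond_ball x n%:R) (@closed_closure _ _) (ex_intro _ _ closed_span0)
  (fun y Yy => uncond_ball_union ubx Yy).
have app y : closed_span x y -> `|y - y0| < r -> forall d, 0 < d ->
    exists y', uncond_ball x n.+1%:R y' /\ `|y - y'| < d.
  move=> Yy yr d d0; have [y' [[a [ay aM]] yy']] := H y Yy yr _ (nbhsx_ballx y _ d0).
  exists y'; split; last by move: yy'; rewrite -ball_normE/=.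
  by exists a; split => // F uF; rewrite (le_trans (aM F uF))// ler_nat.
exists (n.+1%:R + n.+1%:R), r; split=> // y Yy yr d d0.
have d20 : 0 < d / 2 by rewrite divr_gt0.
have [|y1 [b1 d1]] := app (y0 + y) (closed_spanD Y0 Yy) _ _ d20; first by rewrite addrC addKr.
have [|y2 [b2 d2]] := app y0 Y0 _ _ d20; first by rewrite subrr normr0.
exists (y1 - y2); split; first exact: uncond_ballB.
have -> : y - (y1 - y2) = (y0 + y - y1) - (y0 - y2).
  rewrite !opprB [y0 + y]addrC [y + y0 - y1]addrAC -[RHS]addrA [y0 + _]addrC subrK.
  by rewrite addrA addrAC.
by apply: (le_lt_trans (ler_normB _ _)); lra.
Qed.

(** As in the open mapping theorem: approximate, rescale the remainder, approximate again, and add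
    up the coefficient sequences, which decay geometrically. Density becomes membership at the cost
    of doubling [M]. *)
Lemma uncond_ball_open : exists (M r : R), [/\ 0 < M, 0 < r & forall y,
  closed_span x y -> `|y| < r -> uncond_ball x M y].
Proof.
have [M [r [M0 r0 app]]] := uncond_ball_approx.
exists (M + M), r; split; rewrite ?addr_gt0// => y Yy yr.
have h0 k : 0 < (2^-1 ^+ k : R) by rewrite exprn_gt0.
(* At stage [k] a remainder below [r / 2^k] gets an approximant with finite sums bounded by
   [M / 2^k], and the new remainder is below [r / 2^(k+1)]. *)
have /choice[w wP] : forall p : nat * V, exists w : V * (nat -> R),
    closed_span x p.2 -> `|p.2| < r * 2^-1 ^+ p.1 ->
    [/\ series (fun i => w.2 i *: x i) @ \oo --> w.1,
     forall F, uniq F -> `|\sum_(j <- F) w.2 j *: x j| <= M * 2^-1 ^+ p.1 &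
     `|p.2 - w.1| < r * 2^-1 ^+ p.1.+1].
  move=> [k z]/=; have [[Yz zr]|nz] := pselect (closed_span x z /\ `|z| < r * 2^-1 ^+ k); last first.
    by exists (0, fun=> 0) => ? ?; exfalso; apply: nz.
  have [|||z' [ub zz']] := app (2 ^+ k *: z) _ _ (r / 2).
  - exact: closed_spanZ.
  - by rewrite normrZ ger0_norm ?exprn_ge0// -ltr_pdivlMl ?exprn_gt0// mulrC -exprVn.
  - by rewrite divr_gt0.
  have [a [az aM]] := uncond_ballZ (2^-1 ^+ k) ub.
  exists (2^-1 ^+ k *: z', a) => _ _; split=> //=.
    by move=> F uF; rewrite mulrC; have := aM F uF; rewrite ger0_norm// ltW.
  have -> : z - 2^-1 ^+ k *: z' = 2^-1 ^+ k *: (2 ^+ k *: z - z').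
    by rewrite scalerBr scalerA -exprMn mulVf// expr1n scale1r.
  by rewrite normrZ gtr0_norm// exprS mulrA mulrC ltr_pM2r.
pose z := fix z n := if n is m.+1 then z m - (w (m, z m)).1 else y.
have zP n : closed_span x (z n) /\ `|z n| < r * 2^-1 ^+ n.
  elim: n => [|n [Yz zr]] /=; first by rewrite expr0 mulr1.
  have [wz wM wr] := wP (n, z n) Yz zr; split=> //.
  by apply: closed_spanB => //; exact: closed_span_series wz.
pose al n := (w (n, z n)).2.
have alP n F : uniq F -> `|\sum_(j <- F) al n j *: x j| <= M * 2^-1 ^+ n.
  by move=> uF; have [Yz zr] := zP n; have [_ /(_ F uF)] := wP (n, z n) Yz zr.
pose A m i := \sum_(k < m) al k i.
have AS m i : A m.+1 i = A m i + al m i by rewrite /A big_ord_recr.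
have Ay m : series (fun i => A m i *: x i) @ \oo --> y - z m.
  elim: m => [|m IH].
    rewrite /= subrr (_ : series _ = fun=> 0); first exact: cvg_cst.
    by apply/funext => n; rewrite /series/= big1// => i _; rewrite /A big_ord0 scale0r.
  have [Yz zr] := zP m; have [wz _ _] := wP (m, z m) Yz zr.
  rewrite (_ : (fun i => _) = (fun i => A m i *: x i) + (fun i => al m i *: x i)); last first.
    by apply/funext => i; rewrite AS scalerDl fctE.
  by rewrite /= opprB addrCA [_ + (y - _)]addrC seriesD; exact: cvgD.
have Adiff n m F : (n <= m)%N -> uniq F ->
    `|\sum_(j <- F) (A m j - A n j) *: x j| <= M * (2 * (2^-1 ^+ n - 2^-1 ^+ m)).
  move=> nm uF; rewrite -(subnK nm); elim: (m - n)%N => [|k IH].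
    by rewrite add0n !subrr !mulr0 big1 ?normr0// => j _; rewrite subrr scale0r.
  rewrite addSn; under eq_bigr do rewrite AS addrAC scalerDl.
  rewrite big_split/= (le_trans (ler_normD _ _))//.
  apply: (le_trans (lerD IH (alP (k + n)%N F uF))).
  by rewrite -mulrDr ler_pM2l// exprS; lra.
have Adiff' n m F : (n <= m)%N -> uniq F ->
    `|\sum_(j <- F) (A m j - A n j) *: x j| <= (M + M) * 2^-1 ^+ n.
  move=> nm uF; apply: (le_trans (Adiff n m F nm uF)).
  have -> : (M + M) * 2^-1 ^+ n = M * (2 * 2^-1 ^+ n) by ring.
  by rewrite ler_pM2l// ler_pM2l// gerBl ltW.
(* The bound on one-term sums controls the change of the [i]-th coefficient, because [x i] is
   nonzero. *)
have /choice[a aP] : forall i, exists l : R, (fun m => A m i) @ \oo --> l.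
  move=> i; have xi := basic_seq_neq0 i.
  have C0 : 0 <= (M + M) / `|x i| by rewrite divr_ge0// addr_ge0// ltW.
  have [n m nm|l [ml _]] := @geometric_cauchy R R (fun m => A m i) _ C0; last by exists l.
  rewrite mulrAC ler_pdivlMr ?normr_gt0// -normrZ.
  by have := Adiff' n m [:: i] nm isT; rewrite big_seq1.
have aA n F : uniq F -> `|\sum_(j <- F) (a j - A n j) *: x j| <= (M + M) * 2^-1 ^+ n.
  move=> uF.
  have cv : (fun m => `|\sum_(j <- F) (A m j - A n j) *: x j|) @ \oo -->
      `|\sum_(j <- F) (a j - A n j) *: x j|.
    apply: cvg_norm; elim: F {uF} => [|j F IH].
      by under eq_fun do rewrite big_nil; rewrite big_nil; exact: cvg_cst.
    under eq_fun do rewrite big_cons; rewrite big_cons; apply: cvgD IH.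
    by apply: cvgZr_tmp; apply: cvgB => //; exact: cvg_cst.
  apply: (@closed_cvg _ _ \oo _ _ (fun r : R => r <= _) (@closed_le R _) _ _ cv).
  by exists n => // m /= nm; exact: Adiff'.
exists a; split; last first.
  move=> F uF; have := aA 0%N F uF; rewrite expr0 mulr1.
  by under eq_bigr do rewrite /A big_ord0 subr0.
apply/cvgrPdist_le => e e0.
have e20 : 0 < e / 2 by rewrite divr_gt0.
have MMr : 0 <= M + M + r by rewrite !addr_ge0// ltW.
have [m mP] := half_exp_small MMr e20.
have /cvgrPdist_le/(_ _ e20)[N _ NP] := Ay m.
exists N => // n Nn; have {NP} := NP n Nn; rewrite /series/=.
have := aA m (index_iota 0 n) (iota_uniq _ _).
rewrite (eq_bigr _ (fun i _ => scalerBl (a i) (A m i) (x i))) sumrB; have [_] := zP m; move: mP.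
set S := \sum_(_ <= _ < _) a _ *: _; set S' := \sum_(_ <= _ < _) A m _ *: _ => mP zr SS yS.
have -> : y - S = (y - z m - S') - (S - S') + z m.
  by rewrite opprB addrA subrK addrAC subrK.
have h : (M + M + r) * 2^-1 ^+ m = (M + M) * 2^-1 ^+ m + r * 2^-1 ^+ m by ring.
have := ler_normD (y - z m - S' - (S - S')) (z m).
have := ler_normB (y - z m - S') (S - S').
by lra.
Qed.

(** A finite sum is scaled into the ball of [uncond_ball_open]; uniqueness of expansions forces the
    coefficients found there to be the scaled ones, so every partial selection of terms is
    bounded. *)
Lemma uncond_basic_suppressing : exists K, suppressing x K.
Proof.
have [M [r [M0 r0 op]]] := uncond_ball_open.
exists (M / r); split=> [|a F P uF]; first exact: divr_gt0.
set y := \sum_(j <- F) _.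
have cy := @finite_series a F xpredT uF; rewrite -/y in cy.
have Yy := closed_span_series cy.
apply/ler_addgt0Pr => e e0.
(* The extra [e * r / M] makes the scaled norm strictly less than [r], also for [y = 0], and costs
   exactly [e] in the final bound. *)
pose t := `|y| + e * r / M.
have t0 : 0 < t by rewrite ltr_wpDl// divr_gt0// mulr_gt0.
have rt0 : 0 < r / t by rewrite divr_gt0.
have [|b [by_ bM]] := op ((r / t) *: y) (@closed_spanZ _ _ Yy).
  rewrite normrZ gtr0_norm// mulrAC ltr_pdivrMr// ltr_pM2l//.
  by rewrite ltrDl divr_gt0// mulr_gt0.
have [bx _] := ubx.
have [a' [_ a'U]] := bx _ (@closed_spanZ (r / t) _ Yy).
have eb : b = fun i => r / t * (if (i \in F) && xpredT i then a i else 0).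
  rewrite -(a'U _ by_); apply: a'U.
  rewrite (_ : (fun i => _) = (r / t) *: (fun i => (if (i \in F) && xpredT i then a i else 0) *: x i)).
    by rewrite seriesZ; exact: cvgZl_tmp.
  by apply/funext => i; rewrite fctE scalerA.
have := bM [seq j <- F | P j] (filter_uniq _ uF).
rewrite (eq_big_seq (fun j => (r / t) *: (a j *: x j))); last first.
  by move=> j; rewrite mem_filter => /andP[_ jF]; rewrite eb jF/= scalerA.
rewrite big_filter -scaler_sumr normrZ gtr0_norm// mulrC -ler_pdivlMr// => /le_trans; apply.
rewrite invf_div mulrA ler_pdivrMr// /t.
rewrite [leRHS](_ : _ = M * (`|y| + e * r / M))//.
by field; rewrite !gt_eqF.
Qed.

End OpenMapping.

(** * Equivalence is domination in both directions *)

Section Domination.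
Variable R : realType.

Definition dominated {V W : normedModType R} (y : nat -> W) (x : nat -> V) (C : R) :=
  forall (a : nat -> R) (n : nat),
    `|\sum_(0 <= i < n) a i *: y i| <= C * `|\sum_(0 <= i < n) a i *: x i|.

Lemma sum_nat_sub (V : zmodType) (f : nat -> V) (p m N M : nat) :
  (N <= p)%N -> (m <= M)%N ->
  \sum_(p <= i < m) f i = \sum_(N <= i < M | (p <= i < m)%N) f i.
Proof.
move=> Np mM; rewrite (big_nat_widen _ _ _ _ _ mM) (big_nat_widenl _ _ _ _ _ Np).
by apply: eq_bigl => i; rewrite andbC.
Qed.

Lemma suppressing_nat (V : normedModType R) (x : nat -> V) K (a : nat -> R) p m N M :
  suppressing x K -> (N <= p)%N -> (m <= M)%N ->
  `|\sum_(p <= i < m) a i *: x i| <= K * `|\sum_(N <= i < M) a i *: x i|.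
Proof.
move=> [K0 sK] Np mM; rewrite (sum_nat_sub _ Np mM).
exact: sK (iota_uniq _ _).
Qed.

Lemma dominated_sum_converges (V W : completeNormedModType R) (y : nat -> W) (x : nat -> V) C a :
  dominated y x C -> sum_converges a x -> sum_converges a y.
Proof.
move=> dom /sum_convergesP cx; apply/sum_convergesP => e e0.
(* [C] is an arbitrary real, so a positive bound replaces it before dividing. *)
have C1 : 0 < `|C| + 1 by rewrite ltr_wpDl.
have [N NP] := cx _ (divr_gt0 e0 C1); exists N => n m Nn.
have h (U : lmodType R) (z : nat -> U) : \sum_(n <= i < m) a i *: z i =
    \sum_(0 <= i < m) (if (n <= i)%N then a i else 0) *: z i.
  rewrite (big_nat_widenl _ _ _ _ _ (leq0n n)) big_mkcond/=.
  by apply: eq_bigr => i _; case: ifP; rewrite ?scale0r.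
rewrite h (le_trans (dom _ _))// -h.
apply: (@le_trans _ _ ((`|C| + 1) * `|\sum_(n <= i < m) a i *: x i|)).
  by rewrite ler_wpM2r// (le_trans (ler_norm _))// lerDl.
by rewrite mulrC -ler_pdivlMr// NP.
Qed.

(** The first [N] terms cannot cause the failure: suppression bounds each coefficient by the norm of
    the [x]-sum, so these terms cost at most a fixed multiple [D] of it. Non-domination with the
    constant [C * K + D] leaves an excess in the tail. *)
Lemma not_dominated_tail (V W : normedModType R) (y : nat -> W) (x : nat -> V) K :
  suppressing x K -> (forall i, x i != 0) -> (forall C, ~ dominated y x C) ->
  forall (N : nat) (C : R), 0 <= C -> exists (n : nat) (a : nat -> R),
    C * `|\sum_(N <= i < n) a i *: x i| < `|\sum_(N <= i < n) a i *: y i|.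
Proof.
move=> sx x0 nd N C C0; have [K0 sK] := sx.
pose D := \sum_(0 <= i < N) K * `|y i| / `|x i|.
have /existsNP[a /existsNP[n /negP]] := nd (C * K + D); rewrite -ltNge => lt.
exists n, a; set T := `|\sum_(0 <= i < n) a i *: x i| in lt.
have T0 : 0 <= T by exact: normr_ge0.
have h1 : `|\sum_(N <= i < n) a i *: x i| <= K * T by exact: suppressing_nat.
have h2 : `|\sum_(0 <= i < n | (i < N)%N) a i *: y i| <= D * T.
  rewrite (le_trans (ler_norm_sum _ _ _))// /D mulr_suml.
  have ai i : (i < n)%N -> `|a i *: y i| <= K * `|y i| / `|x i| * T.
    move=> ilt; have xi : 0 < `|x i| by rewrite normr_gt0.
    have := suppressing_nat a sx (leq0n i) ilt; rewrite big_nat1 !normrZ -/T => h.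
    rewrite [leRHS](_ : _ = (K * T / `|x i|) * `|y i|); last by ring.
    by rewrite ler_wpM2r// ler_pdivlMr.
  rewrite big_nat_cond.
  apply: (@le_trans _ _ (\sum_(0 <= i < n | (i < N)%N) K * `|y i| / `|x i| * T)).
    by rewrite [leRHS]big_nat_cond; apply: ler_sum => i /andP[/andP[_ /ai]].
  have nn i : 0 <= K * `|y i| / `|x i| * T by rewrite mulr_ge0// divr_ge0// mulr_ge0// ltW.
  have [nN|Nn] := leqP n N.
    rewrite [leLHS](_ : _ = \sum_(0 <= i < n) K * `|y i| / `|x i| * T); last first.
      rewrite [LHS]big_nat_cond [RHS]big_nat_cond; apply: eq_bigl => i.
      by rewrite andbT; case: (ltnP i n) => //= ilt; rewrite (leq_trans ilt nN).
    by rewrite [leRHS](big_cat_nat _ nN)//= lerDl sumr_ge0.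
  by rewrite (big_nat_widen _ _ _ _ _ (ltnW Nn)).
have h3 : `|\sum_(0 <= i < n) a i *: y i| <=
    `|\sum_(0 <= i < n | (i < N)%N) a i *: y i| + `|\sum_(N <= i < n) a i *: y i|.
  rewrite (bigID (fun i => (i < N)%N))/= (le_trans (ler_normD _ _))// lerD2l.
  rewrite [in leRHS](big_nat_widenl _ _ _ _ _ (leq0n N)).
  by under [in leRHS]eq_bigl do rewrite leqNgt/=.
have h4 : C * `|\sum_(N <= i < n) a i *: x i| <= C * (K * T) by rewrite ler_wpM2l.
rewrite mulrDl -mulrA in lt.
by lra.
Qed.

(* Gliding hump: blocks witnessing the failure of domination are glued into one
   series converging along x but not along y. *)
Lemma sum_converges_dominated (V W : completeNormedModType R) (y : nat -> W) (x : nat -> V) K :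
  suppressing x K -> (forall i, x i != 0) ->
  (forall a, sum_converges a x -> sum_converges a y) -> exists C, dominated y x C.
Proof.
move=> sx x0 cxy; have [K0 _] := sx; apply: contrapT => /forallNP nd.
(* [p] holds the start of a block and its number [k]. Dividing by the norm of the [y]-sum makes that
   norm 1 and the norm of the [x]-sum at most [2^-k]. *)
have step (p : nat * nat) : exists q : nat * (nat -> R),
    [/\ (p.1 < q.1)%N, `|\sum_(p.1 <= i < q.1) q.2 i *: x i| <= 2^-1 ^+ p.2 &
    `|\sum_(p.1 <= i < q.1) q.2 i *: y i| = 1].
  case: p => [N k] /=.
  have k0 : 0 <= (2 ^+ k : R) by rewrite exprn_ge0.
  have [n [a lt]] := not_dominated_tail sx x0 nd N k0.
  set X := `|_| in lt; set Y := `|_| in lt.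
  have Y0 : 0 < Y by apply: le_lt_trans lt; rewrite mulr_ge0// normr_ge0.
  exists (n, fun i => Y^-1 * a i) => /=; split.
  - rewrite ltnNge; apply: contraTN Y0 => nN.
    by rewrite /Y big_geq// normr0 ltxx.
  - under eq_bigr do rewrite -scalerA.
    rewrite -scaler_sumr normrZ gtr0_norm ?invr_gt0// -/X exprVn.
    by rewrite mulrC ler_pdivrMr// mulrC ler_pdivlMr ?exprn_gt0// mulrC ltW.
  - under eq_bigr do rewrite -scalerA.
    by rewrite -scaler_sumr normrZ gtr0_norm ?invr_gt0// -/Y mulVf// gt_eqF.
have /choice[q qP] := step.
pose N := fix N k := if k is j.+1 then (q (N j, j)).1 else 0%N.
pose b k := (q (N k, k)).2.
have NS k : (N k < N k.+1)%N by have [] := qP (N k, k).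
have Nk k : (k <= N k)%N by elim: k => // k IH; exact: leq_ltn_trans IH (NS k).
have Nmono k l : (k <= l)%N -> (N k <= N l)%N.
  by move=> /subnK <-; elim: (l - k)%N => // m IH; rewrite (leq_trans IH)// addSn ltnW.
(* The blocks partition nat, so the chosen [k] is the only block containing [i]. *)
pose a i := b (xget 0%N [set k | (N k <= i < N k.+1)%N]) i.
have aE k i : (N k <= i < N k.+1)%N -> a i = b k i.
  move=> /andP[k1 k2]; rewrite /a; case: xgetP => [l _ /= /andP[l1 l2]|/(_ k)/=]; last first.
    by rewrite k1 k2.
  suff -> : l = k by [].
  apply/eqP; rewrite eqn_leq; apply/andP; split; rewrite leqNgt; apply/negP => /Nmono.
    by move=> /(leq_trans k2)/leq_trans/(_ l1); rewrite ltnn.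
  by move=> /(leq_trans l2)/leq_trans/(_ k1); rewrite ltnn.
have aS (U : lmodType R) (z : nat -> U) k :
    \sum_(N k <= i < N k.+1) a i *: z i = \sum_(N k <= i < N k.+1) b k i *: z i.
  by rewrite !big_nat; apply: eq_bigr => i /aE ->.
have ax k j : `|\sum_(N k <= i < N (k + j)%N) a i *: x i| <= 2 * (2^-1 ^+ k - 2^-1 ^+ (k + j)).
  elim: j => [|j IH]; first by rewrite addn0 big_geq// normr0 subrr mulr0.
  rewrite addnS (@big_cat_nat _ _ _ (N (k + j)%N))/=; last 2 first.
  - exact/Nmono/leq_addr.
  - exact: (ltnW (NS (k + j)%N)).
  rewrite (le_trans (ler_normD _ _))// aS.
  have [_ + _] := qP (N (k + j)%N, (k + j)%N); rewrite -[q _]/(q _) /= => h.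
  by apply: (le_trans (lerD IH h)); rewrite exprS; lra.
have /cxy/sum_convergesP cy : sum_converges a x.
  apply/sum_convergesP => e e0.
  have K2 : 0 <= 2 * K by rewrite mulr_ge0// ltW.
  have [k kP] := half_exp_small K2 e0; exists (N k) => n m kn.
  apply: (le_trans (@suppressing_nat _ x K a n m (N k) (N (k + m)%N) sx kn _)).
    exact: leq_trans (leq_addl _ _) (Nk _).
  apply: le_trans kP; rewrite [leRHS](_ : _ = K * (2 * 2^-1 ^+ k)); last by ring.
  rewrite ler_pM2l// (le_trans (ax _ _))// ler_pM2l// gerBl exprn_ge0//.
have h20 : 0 < (2^-1 : R) by rewrite invr_gt0.
have [M MP] := cy _ h20; have := MP (N M) (N M.+1) (Nk M).
have [_ _] := qP (N M, M); rewrite aS => /= -> .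
by rewrite leNgt => /negP; apply; rewrite invf_lt1// ltr1n.
Qed.

(** Domination transports convergence, and the gliding hump gives the converse. The constant is a
    natural number so that its existence is a countable union in the Borel computation. *)
Lemma seq_equivP (V W : completeNormedModType R) (x : nat -> V) (y : nat -> W) K L :
  suppressing x K -> suppressing y L -> (forall i, x i != 0) -> (forall i, y i != 0) ->
  seq_equiv x y <-> exists C : nat, dominated x y C%:R /\ dominated y x C%:R.
Proof.
move=> sx sy x0 y0; split=> [xy|[C [xy yx]] a]; last first.
  by split; exact: dominated_sum_converges.
have [C CP] := sum_converges_dominated sx x0 (fun a => (xy a).1).
have [D DP] := sum_converges_dominated sy y0 (fun a => (xy a).2).
exists (Num.trunc (Num.max C D)).+1; split=> a n.
  apply: le_trans (DP a n) _; rewrite ler_wpM2r// ltW//.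
  by apply: le_lt_trans (truncnS_gt _); rewrite le_max lexx orbT.
apply: le_trans (CP a n) _; rewrite ler_wpM2r// ltW//.
by apply: le_lt_trans (truncnS_gt _); rewrite le_max lexx.
Qed.

End Domination.

(** * Increasing enumerations *)

Definition increasing_nat (g : nat -> nat) := forall i, (g i < g i.+1)%N.

Lemma increasing_nat_lt g i j : increasing_nat g -> (i < j)%N -> (g i < g j)%N.
Proof.
move=> gi; elim: j => // j IH; rewrite ltnS leq_eqVlt => /orP[/eqP ->//|/IH].
by move=> /ltn_trans; apply.
Qed.

Lemma increasing_nat_inj g : increasing_nat g -> injective g.
Proof.
move=> gi i j; case: (ltngtP i j) => // /(increasing_nat_lt gi) + e;
by rewrite e ltnn.
Qed.

Lemma increasing_nat_ge g i : increasing_nat g -> (i <= g i)%N.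
Proof. by move=> gi; elim: i => // i IH; exact: leq_ltn_trans IH (gi i). Qed.

Lemma increasing_nat_eq g e : increasing_nat g -> increasing_nat e ->
  (forall i, exists j, g i = e j) -> (forall i, exists j, e i = g j) -> g = e.
Proof.
move=> gi ei ge eg.
have le u v i : increasing_nat u -> increasing_nat v -> (forall j, exists k, v j = u k) ->
    (forall j, (j < i)%N -> u j = v j) -> (u i <= v i)%N.
  move=> ui vi uv uvE; have [k vk] := uv i.
  rewrite vk; have [ik|ki|->//] := ltngtP i k.
    by rewrite ltnW// increasing_nat_lt.
  by have := increasing_nat_lt vi ki; rewrite vk uvE// ltnn.
apply/funext => i; elim/ltn_ind: i => i IH.
by apply/eqP; rewrite eqn_leq !le// => j /IH.
Qed.

Section EnumInc.
Variables (N : nat -> bool).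
Hypothesis infN : inf_subset_nat N.

Lemma enum_inc_ex n : exists m, N m /\ count N (iota 0 m) = n.
Proof.
have large k : exists m, (k <= count N (iota 0 m))%N.
  elim: k => [|k [m mk]]; first by exists 0%N.
  have [p [mp Np]] := infN m; exists p.+1.
  rewrite -(addn1 p) iotaD count_cat/= add0n Np addn0 addn1 ltnS (leq_trans mk)//.
  by rewrite -(subnKC mp) iotaD count_cat leq_addr.
(* The least [m] whose initial segment holds [n.+1] elements is the successor of the element
   sought. *)
have [m mP mmin] := ex_minnP (large n.+1).
case: m => [|m] in mP mmin *; first by [].
exists m; move: mP; rewrite -(addn1 m) iotaD count_cat/= add0n addn0.
have : (count N (iota 0 m) <= n)%N.
  by rewrite leqNgt; apply/negP => /mmin; rewrite ltnn.
by case: (N m) => /=; [move=> h1 h2; split=> //; lia|lia].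
Qed.

Lemma enum_inc_spec n : N (enum_inc N n) /\ count N (iota 0 (enum_inc N n)) = n.
Proof.
rewrite /enum_inc; case: xgetP => [m _ //|H].
by have [m mP] := enum_inc_ex n; case: (H m).
Qed.

Lemma enum_inc_mem n : N (enum_inc N n). Proof. by case: (enum_inc_spec n). Qed.

Lemma enum_inc_increasing : increasing_nat (enum_inc N).
Proof.
move=> n; rewrite ltnNge; apply/negP => le.
have [_ c1] := enum_inc_spec n; have [_ c2] := enum_inc_spec n.+1.
have := leq_addr (count N (iota (0 + enum_inc N n.+1) (enum_inc N n - enum_inc N n.+1)))
  (count N (iota 0 (enum_inc N n.+1))).
by rewrite -count_cat -iotaD subnKC// c1 c2 ltnn.
Qed.

Lemma enum_inc_inj : injective (enum_inc N).
Proof. exact/increasing_nat_inj/enum_inc_increasing. Qed.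

Lemma enum_inc_surj m : N m -> exists n, enum_inc N n = m.
Proof.
move=> Nm; exists (count N (iota 0 m)); set n := count _ _.
have [Ne ce] := enum_inc_spec n.
have lt p q : N p -> (p < q)%N -> (count N (iota 0 p) < count N (iota 0 q))%N.
  move=> Np pq; have -> : q = (p + (1 + (q - p).-1))%N by lia.
  by rewrite iotaD count_cat/= add0n Np; lia.
case: (ltngtP (enum_inc N n) m) => // [/(lt _ _ Ne)|/(lt _ _ Nm)].
  by rewrite ce ltnn.
by rewrite ce ltnn.
Qed.

Lemma enum_incE g : increasing_nat g -> (forall i, N (g i)) ->
  (forall m, N m -> exists i, g i = m) -> enum_inc N = g.
Proof.
move=> gi gN Ng; apply: increasing_nat_eq => // [|i|i].
- exact: enum_inc_increasing.
- by have [j] := Ng _ (enum_inc_mem i); exists j.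
- by have [j] := enum_inc_surj (gN i); exists j.
Qed.

End EnumInc.

Section EnumIncImage.
Variables (N A : nat -> bool).
Hypotheses (infN : inf_subset_nat N) (infA : inf_subset_nat A).

Definition enum_image (k : nat) : bool := `[< exists i, enum_inc N i = k /\ A i >].

Lemma enum_image_inf : inf_subset_nat enum_image.
Proof.
move=> n; have [i [ni Ai]] := infA n; exists (enum_inc N i); split.
  exact: leq_trans ni (increasing_nat_ge _ (enum_inc_increasing infN)).
by apply/asboolP; exists i.
Qed.

(** The reduction uses this to turn a subsequence of a subsequence into a single subsequence of the
    universal basis. *)
Lemma enum_inc_image : enum_inc enum_image = enum_inc N \o enum_inc A.
Proof.
apply: (enum_incE enum_image_inf).
- move=> i; apply: (increasing_nat_lt (enum_inc_increasing infN)).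
  exact: (enum_inc_increasing infA).
- by move=> i; apply/asboolP; exists (enum_inc A i); split => //; exact: enum_inc_mem.
- move=> m /asboolP[i [<- Ai]]; have [j ji] := enum_inc_surj infA Ai.
  by exists j; rewrite /= ji.
Qed.

End EnumIncImage.

(** * Borel sets *)

Lemma gen_sigma_algebra (T : Type) (G : set (set T)) : is_sigma_algebra (gen_sigma G).
Proof.
split; [|split].
- by move=> M [M0 _] _.
- by move=> A GA M sM GM; have [_ [MC _]] := sM; apply: MC; exact: GA.
- by move=> F GF M sM GM; have [_ [_ MU]] := sM; apply: MU => n; exact: GF.
Qed.

Lemma sub_gen_sigma (T : Type) (G : set (set T)) : G `<=` gen_sigma G.
Proof. by move=> A GA M _; exact. Qed.

Lemma is_sigma_algebra_preimage (T U : Type) (f : T -> U) (S : set (set T)) :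
  is_sigma_algebra S -> is_sigma_algebra [set A | S (f @^-1` A)].
Proof.
by move=> [S0 [SC SU]]; split; [|split] => //= [A|F SF]; [exact: SC|exact: SU].
Qed.

Section Measurability.
Variables (T : Type) (S : set (set T)).
Hypothesis sS : is_sigma_algebra S.
Implicit Types (P Q : T -> Prop).

Lemma sigma_not P : S P -> S (fun p => ~ P p).
Proof. by have [_ [SC _]] := sS; exact: SC. Qed.

Lemma sigma_ext P Q : (forall p, P p <-> Q p) -> S P -> S Q.
Proof. by move=> PQ; rewrite (_ : P = Q)//; apply/funext => p; exact/propext. Qed.

Lemma sigma_const (b : Prop) : S (fun=> b).
Proof.
have [S0 [SC _]] := sS; have [hb|nb] := pselect b.
  by apply: sigma_ext (SC _ S0) => p; split=> // _ [].
by apply: sigma_ext S0 => p; split=> // [[]].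
Qed.

Lemma sigma_exists (P : nat -> T -> Prop) : (forall n, S (P n)) ->
  S (fun p => exists n, P n p).
Proof.
have [_ [_ SU]] := sS; move=> SP; apply: sigma_ext (SU P SP) => p.
by split=> [[n _ Pn]|[n Pn]]; exists n.
Qed.

Lemma sigma_forall (P : nat -> T -> Prop) : (forall n, S (P n)) ->
  S (fun p => forall n, P n p).
Proof.
move=> SP; apply: sigma_ext (sigma_not (sigma_exists (fun n => sigma_not (SP n)))) => p.
split=> [H n|H [n]]; last by apply; exact: H.
by apply: contrapT => nP; apply: H; exists n.
Qed.

Lemma sigma_or P Q : S P -> S Q -> S (fun p => P p \/ Q p).
Proof.
move=> SP SQ; apply: (@sigma_ext (fun p => exists n, (if n is 0%N then P else Q) p)).
  move=> p; split=> [[[|n]]|[Pp|Qp]]; [by left|by right|by exists 0%N|by exists 1%N].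
by apply: sigma_exists => -[|n].
Qed.

Lemma sigma_and P Q : S P -> S Q -> S (fun p => P p /\ Q p).
Proof.
move=> SP SQ; apply: (@sigma_ext (fun p => forall n, (if n is 0%N then P else Q) p)).
  by move=> p; split=> [H|[Pp Qp] [|n]]//; split; [exact: (H 0%N)|exact: (H 1%N)].
by apply: sigma_forall => -[|n].
Qed.

Lemma sigma_imply P Q : S P -> S Q -> S (fun p => P p -> Q p).
Proof.
move=> SP SQ; apply: sigma_ext (sigma_or (sigma_not SP) SQ) => p.
split=> [[nP|Qp]|PQ]//.
by have [Pp|nP] := pselect (P p); [right; exact: PQ|left].
Qed.

Lemma sigma_exists_count (I : countType) (P : I -> T -> Prop) : (forall i, S (P i)) ->
  S (fun p => exists i, P i p).
Proof.
move=> SP; apply: (@sigma_ext (fun p => exists n,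
    (if @unpickle I n is Some i then P i else fun=> False) p)).
  move=> p; split=> [[n]|[i Pi]]; last by exists (pickle i); rewrite pickleK.
  by case: unpickle => // i Pi; exists i.
apply: sigma_exists => n; case: unpickle => [i//|].
exact: sigma_const.
Qed.

Lemma sigma_comp (I : countType) (f : T -> I) (Q : I -> Prop) :
  (forall k, S (fun p => f p = k)) -> S (fun p => Q (f p)).
Proof.
move=> Sf; apply: (@sigma_ext (fun p => exists k, f p = k /\ Q k)).
  by move=> p; split=> [[k [->]]//|Qp]; exists (f p).
apply: sigma_exists_count => k; apply: sigma_and => //; exact: sigma_const.
Qed.

Lemma sigma_mkseq (I : countType) (f : T -> nat -> I) (n : nat) (s : seq I) :
  (forall i k, S (fun p => f p i = k)) -> S (fun p => mkseq (f p) n = s).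
Proof.
move=> Sf; elim: n s => [|n IH] s; first exact: (sigma_const ([::] = s)).
case/lastP: s => [|s x].
  apply: sigma_ext (sigma_const False) => p; by split => [[]|]; rewrite /mkseq.
apply: sigma_ext (sigma_and (IH s) (Sf n x)) => p.
rewrite /mkseq -(addn1 n) iotaD map_cat/= add0n cats1.
by split=> [[-> ->]//|/rcons_inj[-> ->]].
Qed.

(** [Q] factors through the first [n] values, which range over a countable type of finite sequences,
    so the set is a countable union of fibres; [x0] only pads. *)
Lemma sigma_finite_dep (I : countType) (x0 : I) (f : T -> nat -> I) (n : nat)
    (Q : (nat -> I) -> Prop) :
  (forall i k, S (fun p => f p i = k)) ->
  (forall g h : nat -> I, (forall i, (i < n)%N -> g i = h i) -> Q g -> Q h) ->
  S (fun p => Q (f p)).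
Proof.
move=> Sf QP; have Sm s := sigma_mkseq n s Sf.
apply: sigma_ext (sigma_comp (fun s => Q (nth x0 s)) Sm) => p.
by split; apply: QP => i ilt; rewrite nth_mkseq.
Qed.

End Measurability.

Lemma BorelC_sigma : is_sigma_algebra BorelC. Proof. exact: gen_sigma_algebra. Qed.
Lemma BorelN_sigma : is_sigma_algebra BorelN. Proof. exact: gen_sigma_algebra. Qed.

Lemma BorelC_coord n b : BorelC (fun x => x n = b).
Proof. by apply: sub_gen_sigma; exists n, b. Qed.

Lemma BorelN_coord n k : BorelN (fun x => x n = k).
Proof. by apply: sub_gen_sigma; exists n, k. Qed.

Lemma prod_sigma_fst (X Y : Type) (MX : set (set X)) (MY : set (set Y)) P :
  is_sigma_algebra MY -> MX P -> prod_sigma MX MY (fun p => P p.1).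
Proof.
move=> sY MP; apply: sub_gen_sigma; exists P, setT; split=> //; split.
  exact: (sigma_const sY True).
by apply/seteqP; split=> p //= [].
Qed.

Lemma prod_sigma_snd (X Y : Type) (MX : set (set X)) (MY : set (set Y)) P :
  is_sigma_algebra MX -> MY P -> prod_sigma MX MY (fun p => P p.2).
Proof.
move=> sX MP; apply: sub_gen_sigma; exists setT, P; split; last split=> //.
  exact: (sigma_const sX True).
by apply/seteqP; split=> p //= [].
Qed.

(** * The relation is an analytic quasiorder *)

Section PermSubRel.
Variables (R : realType) (U : completeNormedModType R) (u : nat -> U) (K : R).
Hypotheses (su : suppressing u K) (u0 : forall i, u i != 0).

Lemma suppressing_subseq N : inf_subset_nat N -> suppressing (subseq_at u N) K.
Proof. by move=> iN; exact: suppressing_comp (enum_inc_inj iN) su. Qed.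

Lemma perm_sub_rel_quasiorder : quasiorder_on inf_subset_nat (perm_sub_rel u).
Proof.
split=> [N iN|N M P _ _ _ [iN [iM NM]] [_ [iP MP]]].
  by do 2!split=> //; exists id; split=> // a.
do 2!split=> //.
exact: perm_equiv_sub_trans (suppressing_subseq iM) (suppressing_subseq iP) NM MP.
Qed.

Definition equiv_upto (C n : nat) (g h : nat -> nat) : Prop := forall a : nat -> R,
  `|\sum_(0 <= i < n) a i *: u (g i)| <= C%:R * `|\sum_(0 <= i < n) a i *: u (h i)| /\
  `|\sum_(0 <= i < n) a i *: u (h i)| <= C%:R * `|\sum_(0 <= i < n) a i *: u (g i)|.

Lemma seq_equiv_upto g h : injective g -> injective h ->
  seq_equiv (u \o g) (u \o h) <-> exists C, forall n, equiv_upto C n g h.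
Proof.
move=> gI hI; rewrite (seq_equivP (suppressing_comp gI su) (suppressing_comp hI su)
  (fun i => u0 (g i)) (fun i => u0 (h i))).
split=> [[C [dg dh]]|[C H]]; exists C; first by move=> n a; split; [exact: dg|exact: dh].
by split=> a n; have [] := H n a.
Qed.

(* The witness codes the increasing enumeration of the first set and the
   rearranged enumeration of part of the second, coordinatewise. *)
Definition decode2 (k : nat) : nat * nat := odflt (0, 0)%N (unpickle k).

Definition perm_sub_witness (p : ((nat -> bool) * (nat -> bool)) * (nat -> nat)) : Prop :=
  let g i := (decode2 (p.2 i)).1 in let h i := (decode2 (p.2 i)).2 in
  (inf_subset_nat p.1.1 /\ inf_subset_nat p.1.2) /\
  ((increasing_nat g /\ (forall i, p.1.1 (g i))) /\ (forall m, p.1.1 m -> exists i, g i = m)) /\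
  ((injective h /\ (forall i, p.1.2 (h i))) /\ exists C, forall n, equiv_upto C n g h).

Lemma perm_sub_witnessE : rel_set (perm_sub_rel u) = fst @` perm_sub_witness.
Proof.
apply/seteqP; split=> [[N M] /= [iN [iM [f [fI e]]]]|p [[[N M] b] /= W <-]].
  have gI := enum_inc_inj iN.
  have hI : injective (enum_inc M \o f) by exact: inj_comp (enum_inc_inj iM) fI.
  exists ((N, M), fun i => pickle (enum_inc N i, enum_inc M (f i))) => //.
  rewrite /perm_sub_witness/=.
  have -> : (fun i => (decode2 (pickle (enum_inc N i, enum_inc M (f i)))).1) = enum_inc N.
    by apply/funext => i; rewrite /decode2 pickleK.
  have -> : (fun i => (decode2 (pickle (enum_inc N i, enum_inc M (f i)))).2) = enum_inc M \o f.
    by apply/funext => i; rewrite /decode2 pickleK.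
  split=> //; split.
    split; first split.
    - exact: enum_inc_increasing.
    - by move=> i; rewrite /decode2 pickleK; exact: enum_inc_mem.
    - by move=> m /(enum_inc_surj iN)[i <-]; exists i; rewrite /decode2 pickleK.
  split; first by split=> // i; rewrite /decode2 pickleK; exact: enum_inc_mem.
  by have [+ _] := seq_equiv_upto gI hI; exact.
case: W => /= -[iN iM] [[[gi gN] Ng] [[hI hM] E]].
split=> //; split=> //.
move: gi gN Ng hI hM E; set g := fun i => (decode2 (b i)).1; set h := fun i => (decode2 (b i)).2 => gi gN Ng hI hM E.
have /choice[f fP] : forall i, exists j, enum_inc M j = h i.
  by move=> i; exact: (enum_inc_surj iM (hM i)).
exists f; split=> [i j ij|]; first by apply: hI; rewrite -!fP ij.
rewrite /subseq_at (enum_incE iN gi gN Ng).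
have -> : u \o enum_inc M \o f = u \o h by apply/funext => i; rewrite /= fP.
by rewrite seq_equiv_upto//; exact: increasing_nat_inj.
Qed.

Lemma perm_sub_witness_borel :
  prod_sigma (prod_sigma BorelC BorelC) BorelN perm_sub_witness.
Proof.
set S := prod_sigma _ _.
have sCC : is_sigma_algebra (prod_sigma BorelC BorelC) by exact: gen_sigma_algebra.
have sS : is_sigma_algebra S by exact: gen_sigma_algebra.
have cN m : S (fun p => p.1.1 m).
  exact: (prod_sigma_fst BorelN_sigma (prod_sigma_fst BorelC_sigma (BorelC_coord m true))).
have cM m : S (fun p => p.1.2 m).
  exact: (prod_sigma_fst BorelN_sigma (prod_sigma_snd BorelC_sigma (BorelC_coord m true))).
have cb i k : S (fun p => p.2 i = k).
  exact: (prod_sigma_snd sCC (BorelN_coord i k)).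
have cd i k : S (fun p => decode2 (p.2 i) = k).
  exact: (sigma_comp sS (fun j => decode2 j = k) (cb i)).
have cdQ i (Q : nat * nat -> Prop) : S (fun p => Q (decode2 (p.2 i))).
  exact: (sigma_comp sS Q (cd i)).
have inf_meas (c : (nat -> bool) * (nat -> bool) * (nat -> nat) -> nat -> bool) :
    (forall m, S (fun p => c p m)) -> S (fun p => inf_subset_nat (c p)).
  move=> Sc; apply: (sigma_forall sS) => n; apply: (sigma_exists sS) => m.
  by apply: (sigma_and sS) => //; exact: (sigma_const sS).
have mem_meas (c : (nat -> bool) * (nat -> bool) * (nat -> nat) -> nat -> bool)
    (d : nat * nat -> nat) : (forall m, S (fun p => c p m)) ->
    S (fun p => forall i, c p (d (decode2 (p.2 i)))).
  move=> Sc; apply: (sigma_forall sS) => i.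
  apply: (@sigma_ext _ S (fun p => exists m, d (decode2 (p.2 i)) = m /\ c p m)).
    by move=> p; split=> [[m [->]]//|H]; exists (d (decode2 (p.2 i))).
  apply: (sigma_exists sS) => m; apply: (sigma_and sS) => //.
  exact: (cdQ i (fun q => d q = m)).
have dep (n : nat) (Q : (nat -> nat * nat) -> Prop) :
    (forall g h, (forall i, (i < n)%N -> g i = h i) -> Q g -> Q h) ->
    S (fun p => Q (fun i => decode2 (p.2 i))).
  by move=> QP; apply: (@sigma_finite_dep _ _ sS _ (0, 0)%N (fun p i => decode2 (p.2 i)) n).
apply: (sigma_and sS); first by apply: (sigma_and sS); exact: inf_meas.
apply: (sigma_and sS); [apply: (sigma_and sS); first apply: (sigma_and sS)|].
- apply: (sigma_forall sS) => n.
  apply: (dep n.+2 (fun g => ((g n).1 < (g n.+1).1)%N)) => g h gh.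
  by rewrite !gh// ltnS.
- exact: (mem_meas (fun p => p.1.1) fst).
- apply: (sigma_forall sS) => m; apply: (sigma_imply sS) => //.
  by apply: (sigma_exists sS) => i; exact: (cdQ i (fun q => q.1 = m)).
apply: (sigma_and sS); [apply: (sigma_and sS)|].
- apply: (@sigma_ext _ S (fun p => forall i j,
     (decode2 (p.2 i)).2 = (decode2 (p.2 j)).2 -> i = j)) => //.
  apply: (sigma_forall sS) => i; apply: (sigma_forall sS) => j.
  apply: (dep (maxn i j).+1 (fun g => (g i).2 = (g j).2 -> i = j)) => g h gh.
  by rewrite !gh// ltnS ?leq_maxl ?leq_maxr.
- exact: (mem_meas (fun p => p.1.2) snd).
apply: (sigma_exists sS) => C; apply: (sigma_forall sS) => n.
(* The condition quantifies over all real [a], but it depends on the witness only through its first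
   [n] values. *)
apply: (dep n (fun g => equiv_upto C n (fun i => (g i).1) (fun i => (g i).2))) => g h gh E a.
have h1 : \sum_(0 <= i < n) a i *: u (h i).1 = \sum_(0 <= i < n) a i *: u (g i).1.
  by rewrite !big_nat; apply: eq_bigr => i /gh ->.
have h2 : \sum_(0 <= i < n) a i *: u (h i).2 = \sum_(0 <= i < n) a i *: u (g i).2.
  by rewrite !big_nat; apply: eq_bigr => i /gh ->.
by rewrite h1 h2; exact: E.
Qed.

Lemma perm_sub_rel_analytic :
  analytic_set (prod_sigma BorelC BorelC) (rel_set (perm_sub_rel u)).
Proof.
exists perm_sub_witness; split; first exact: perm_sub_witness_borel.
exact: perm_sub_witnessE.
Qed.

End PermSubRel.

(** * Analytic relations as projections of closed sets *)

Definition agree (A : Type) (k : nat) (x y : nat -> A) := forall i, (i < k)%N -> x i = y i.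

Lemma agree_le (A : Type) k l (x y : nat -> A) : (k <= l)%N -> agree l x y -> agree k x y.
Proof. by move=> kl xy i ik; apply: xy; exact: leq_trans ik kl. Qed.

Lemma agree_sym (A : Type) k (x y : nat -> A) : agree k x y -> agree k y x.
Proof. by move=> xy i /xy. Qed.

Lemma agree_trans (A : Type) k (x y z : nat -> A) : agree k x y -> agree k y z -> agree k x z.
Proof. by move=> xy yz i ik; rewrite xy// yz. Qed.

Definition closed_rel (F : (nat -> nat) -> (nat -> nat) -> Prop) :=
  forall x b, (forall k, exists x' b', [/\ agree k x' x, agree k b' b & F x' b']) -> F x b.

(** * Suslin sets as projections of closed sets *)

Section Suslin.
Variables (Y : Type) (code : Y -> nat -> nat).
Implicit Types D : set Y.

Definition suslin D := exists F, closed_rel F /\ forall y, D y <-> exists b, F (code y) b.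

Lemma suslin_ext D D' : (forall y, D y <-> D' y) -> suslin D -> suslin D'.
Proof. by move=> DD' [F [cF DF]]; exists F; split=> // y; rewrite -DD'. Qed.

Lemma suslin_coord (i : nat) (Q : nat -> Prop) : suslin (fun y => Q (code y i)).
Proof.
exists (fun x _ => Q (x i)); split=> [x b /(_ i.+1)[x' [_ [xx' _]]]|y]; first by rewrite xx'.
by split=> [Qy|[]//]; exists (code y).
Qed.

(** The first entry of the witness names [n], the rest is a witness for [D n]. *)
Lemma suslin_exists (D : nat -> set Y) : (forall n, suslin (D n)) ->
  suslin (fun y => exists n, D n y).
Proof.
move=> /choice[F FP]; exists (fun x b => F (b 0%N) x (fun i => b i.+1)); split.
  move=> x b H; have [cF _] := FP (b 0%N); apply: cF => k.
  have [x' [b' [xx' bb' Fx]]] := H k.+1; exists x', (fun i => b' i.+1); split.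
  - exact: agree_le xx'.
  - by move=> i ik; apply: bb'.
  - by rewrite -(bb' 0%N).
move=> y; split=> [[n Dn]|[b Fb]].
  have [_ /(_ y)[/(_ Dn)[b Fb] _]] := FP n.
  by exists (fun i => if i is j.+1 then b j else n).
by exists (b 0%N); have [_ ->] := FP (b 0%N); exists (fun i => b i.+1).
Qed.

(** One witness carries those for all [n] in the rows of a pairing. Closedness holds row by row,
    since [k] entries of a row lie in a finite initial segment. *)
Lemma suslin_forall (D : nat -> set Y) : (forall n, suslin (D n)) ->
  suslin (fun y => forall n, D n y).
Proof.
move=> /choice[F FP]; exists (fun x b => forall n, F n x (fun i => b (pickle (n, i)))); split.
  move=> x b H n; have [cF _] := FP n; apply: cF => k.
  pose K := maxn k (\max_(i < k) (pickle (n, val i)).+1).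
  have [x' [b' [xx' bb' Fx]]] := H K; exists x', (fun i => b' (pickle (n, i))); split=> //.
  - by apply: agree_le xx'; rewrite leq_maxl.
  - move=> i ik; apply: bb'; rewrite leq_max; apply/orP; right.
    exact: (@leq_bigmax _ (fun j : 'I_k => (pickle (n, val j)).+1) (Ordinal ik)).
move=> y; split=> [Dy|[b Fb] n]; last first.
  by have [_ ->] := FP n; exists (fun i => b (pickle (n, i))).
have /choice[c cP] : forall n, exists b, F n (code y) b.
  by move=> n; have [_ /(_ y)[/(_ (Dy n))]] := FP n.
exists (fun m => if @unpickle (nat * nat)%type m is Some (n, i) then c n i else 0%N) => n.
rewrite (_ : (fun i => _) = c n)//.
by apply/funext => i; rewrite pickleK.
Qed.

(** Asking the same of the complement builds closure under complements into the class; it is then a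
    sigma-algebra, and once it contains the generators it contains all Borel sets. *)
Definition bisuslin : set (set Y) := fun D => suslin D /\ suslin (~` D).

Lemma bisuslin_sigma : is_sigma_algebra bisuslin.
Proof.
have s0 : suslin set0 by exact: (@suslin_coord 0%N (fun=> False)).
have sT : suslin setT by exact: (@suslin_coord 0%N (fun=> True)).
split; first by split=> //; rewrite setC0.
split; first by move=> A [sA sCA]; split=> //; rewrite setCK.
move=> F sF; split.
  apply: suslin_ext (suslin_exists (fun n => (sF n).1)) => y.
  by split=> [[n]|[n _]]; exists n.
apply: suslin_ext (suslin_forall (fun n => (sF n).2)) => y.
split=> [H [n _ Fn]|H n Fn]; first exact: (H n).
by apply: H; exists n.
Qed.

Lemma bisuslin_coord (i : nat) (Q : nat -> Prop) : bisuslin (fun y => Q (code y i)).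
Proof.
by split; [exact: suslin_coord|exact: (suslin_coord i (fun k => ~ Q k))].
Qed.

Lemma bisuslin_prod (X1 X2 : Type) (M1 : set (set X1)) (M2 : set (set X2))
    (f1 : Y -> X1) (f2 : Y -> X2) :
  (forall A, M1 A -> bisuslin (f1 @^-1` A)) -> (forall A, M2 A -> bisuslin (f2 @^-1` A)) ->
  forall D : set (X1 * X2), prod_sigma M1 M2 D -> bisuslin ((fun y => (f1 y, f2 y)) @^-1` D).
Proof.
move=> h1 h2 D /(_ _ (is_sigma_algebra_preimage (fun y => (f1 y, f2 y)) bisuslin_sigma)).
apply => _ [A [B [M1A [M2B ->]]]] /=.
exact: (sigma_and bisuslin_sigma (h1 _ M1A) (h2 _ M2B)).
Qed.

Lemma bisuslin_BorelC (f : Y -> nat -> bool) :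
  (forall i b, bisuslin (fun y => f y i = b)) ->
  forall A, BorelC A -> bisuslin (f @^-1` A).
Proof.
move=> hf A /(_ _ (is_sigma_algebra_preimage f bisuslin_sigma)); apply => _ [i [b ->]] /=.
exact: hf.
Qed.

Lemma bisuslin_BorelN (f : Y -> nat -> nat) :
  (forall i b, bisuslin (fun y => f y i = b)) ->
  forall A, BorelN A -> bisuslin (f @^-1` A).
Proof.
move=> hf A /(_ _ (is_sigma_algebra_preimage f bisuslin_sigma)); apply => _ [i [b ->]] /=.
exact: hf.
Qed.

End Suslin.

Definition closed_rel3 (H : (nat -> bool) -> (nat -> bool) -> (nat -> nat) -> Prop) :=
  forall x y d, (forall k, exists x' y' d',
    [/\ agree k x' x, agree k y' y, agree k d' d & H x' y' d']) -> H x y d.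

Section Coding.
Variables (X : Type) (MX : set (set X)) (P : X -> X -> Prop).

(** Transfers [P] to Cantor space as the projection of a closed set. The witness [d] also certifies
    that both points lie in the Borel range of [phi], so [H] holds only at points coming from
    [X]. *)
Lemma analytic_closed_coding : standard_borel MX ->
  analytic_set (prod_sigma MX MX) (rel_set P) ->
  exists (phi : X -> nat -> bool) H,
    [/\ injective phi, forall n b, MX (fun x => phi x n = b), closed_rel3 H,
     forall z w, P z w -> exists d, H (phi z) (phi w) d &
     forall x y d, H x y d -> exists z w, [/\ x = phi z, y = phi w & P z w]].
Proof.
move=> [sX [phi [phiI [rphi MXE]]]] [B [BB PB]].
pose code (p : (X * X) * (nat -> nat)) i : nat := pickle (phi p.1.1 i, phi p.1.2 i, p.2 i).
pose dec (k : nat) : bool * bool * nat := odflt (false, false, 0%N) (unpickle k).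
have decK p i : dec (code p i) = (phi p.1.1 i, phi p.1.2 i, p.2 i).
  by rewrite /dec pickleK.
have h1 A : MX A -> bisuslin code ((fun p => p.1.1) @^-1` A).
  move=> /MXE[C [BC ->]]; apply: (bisuslin_BorelC _ BC) => i b.
  apply: (sigma_ext _ (bisuslin_coord code i (fun k => (dec k).1.1 = b))) => p.
  by rewrite decK.
have h2 A : MX A -> bisuslin code ((fun p => p.1.2) @^-1` A).
  move=> /MXE[C [BC ->]]; apply: (bisuslin_BorelC _ BC) => i b.
  apply: (sigma_ext _ (bisuslin_coord code i (fun k => (dec k).1.2 = b))) => p.
  by rewrite decK.
have h3 A : BorelN A -> bisuslin code ((fun p => p.2) @^-1` A).
  move=> BA; apply: (bisuslin_BorelN _ BA) => i b.
  apply: (sigma_ext _ (bisuslin_coord code i (fun k => (dec k).2 = b))) => p.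
  by rewrite decK.
have [[F [cF BF]] _] : bisuslin code B.
  have h12 := bisuslin_prod h1 h2.
  have := bisuslin_prod h12 h3 BB.
  by rewrite (_ : _ @^-1` _ = B)//; apply/seteqP; split=> -[[z w] g].
pose codeC (x : nat -> bool) i : nat := x i.
have [[G [cG rG]] _] : bisuslin codeC (range phi).
  apply: (bisuslin_BorelC (f := id) _ rphi) => i b.
  apply: (sigma_ext _ (bisuslin_coord codeC i (fun k => (k == 1%N) = b))) => x.
  by rewrite /codeC; case: (x i).
(* The four parts are the given Baire space witness, a Suslin witness for [B], and range witnesses
   for [x] and for [y]. *)
pose d4 (k : nat) : nat * nat * nat * nat := odflt (0, 0, 0, 0)%N (unpickle k).
pose H (x y : nat -> bool) (d : nat -> nat) :=
  [/\ F (fun i => pickle (x i, y i, (d4 (d i)).1.1.1)) (fun i => (d4 (d i)).1.1.2),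
      G (codeC x) (fun i => (d4 (d i)).1.2) & G (codeC y) (fun i => (d4 (d i)).2)].
exists phi, H; split => //.
- by move=> n b; rewrite MXE; exists (fun x => x n = b); split=> //; exact: BorelC_coord.
- move=> x y d Hk; split.
  + apply: cF => k; have [x' [y' [d' [xx' yy' dd' [HF _ _]]]]] := Hk k.
    exists (fun i => pickle (x' i, y' i, (d4 (d' i)).1.1.1)), (fun i => (d4 (d' i)).1.1.2).
    split=> // i ik; first by rewrite xx'// yy'// dd'.
    by rewrite dd'.
  + apply: cG => k; have [x' [y' [d' [xx' yy' dd' [_ HG _]]]]] := Hk k.
    exists (codeC x'), (fun i => (d4 (d' i)).1.2).
    by split=> // i ik; rewrite ?dd'// /codeC xx'.
  + apply: cG => k; have [x' [y' [d' [xx' yy' dd' [_ _ HG]]]]] := Hk k.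
    exists (codeC y'), (fun i => (d4 (d' i)).2).
    by split=> // i ik; rewrite ?dd'// /codeC yy'.
- move=> z w Pzw; have : rel_set P (z, w) by [].
  rewrite PB => -[[[z' w'] g] + [zz ww]]; rewrite zz ww => /BF[b Fb].
  have [_] := rG (phi z); have [/(_ (ex_intro2 _ _ z I erefl))[r1 Gr1] _ _] := rG (phi z).
  have [/(_ (ex_intro2 _ _ w I erefl))[r2 Gr2] _] := rG (phi w).
  exists (fun i => pickle (g i, b i, r1 i, r2 i)); split.
  + rewrite (_ : (fun i => (d4 _).1.1.2) = b); last first.
      by apply/funext => i; rewrite /d4 pickleK.
    by move: Fb; congr (F _ _); apply/funext => i; rewrite /d4 pickleK.
  + by rewrite (_ : (fun i => (d4 _).1.2) = r1)//; apply/funext => i; rewrite /d4 pickleK.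
  + by rewrite (_ : (fun i => (d4 _).2) = r2)//; apply/funext => i; rewrite /d4 pickleK.
- move=> x y d [HF HG1 HG2].
  have [z _ zx] : range phi x by apply/rG; exists (fun i => (d4 (d i)).1.2).
  have [w _ wy] : range phi y by apply/rG; exists (fun i => (d4 (d i)).2).
  exists z, w; split=> //.
  suff : rel_set P (z, w) by [].
  rewrite PB; exists ((z, w), fun i => (d4 (d i)).1.1.1) => //.
  by apply/BF; exists (fun i => (d4 (d i)).1.1.2); rewrite /code/= zx wy.
Qed.

End Coding.

(** * Finite approximations of an analytic quasiorder *)

(** Sequences below [b] form a finitely branching tree, so a prefix that extends to solutions for
    every [k] has a one-step extension with the same property. *)
Lemma koenig (b : nat -> nat) (Q : nat -> (nat -> nat) -> Prop) :
  (forall k c c', agree k c c' -> Q k c -> Q k c') ->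
  (forall k c, Q k.+1 c -> Q k c) ->
  (forall k, exists c, (forall i, (c i <= b i)%N) /\ Q k c) ->
  exists c, forall k, Q k c.
Proof.
move=> Qa Qs Qex.
have Qle k l c : (k <= l)%N -> Q l c -> Q k c.
  by move=> /subnK <-; elim: (l - k)%N => // m IH; rewrite addSn => /Qs.
pose good n (p : nat -> nat) :=
  forall k, exists c, [/\ forall i, (c i <= b i)%N, agree n p c & Q k c].
pose upd n (p : nat -> nat) a i := if i == n then a else p i.
have step n p : good n p -> exists a, good n.+1 (upd n p a).
  move=> gp; apply: contrapT => /forallNP na.
  have /choice[K KP] : forall a, exists k, forall c, (forall i, (c i <= b i)%N) ->
      agree n.+1 (upd n p a) c -> ~ Q k c.
    move=> a; have /existsNP[k nk] := na a; exists k => c cb ac Qc.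
    by apply: nk; exists c.
  (* A length beyond the failures [K a] of the finitely many values [a] contradicts the failure at
     [a = c n]. *)
  have [c [cb pc Qc]] := gp (\max_(a < (b n).+1) K a).
  have cn : (c n < (b n).+1)%N by rewrite ltnS.
  apply: (KP (c n) c cb).
    move=> i; rewrite ltnS leq_eqVlt /upd => /orP[/eqP ->|ilt]; first by rewrite eqxx.
    by rewrite (ltn_eqF ilt) pc.
  apply: Qle Qc.
  exact: (@leq_bigmax _ (fun a : 'I_(b n).+1 => K a) (Ordinal cn)).
have /choice[A AP] : forall q : nat * (nat -> nat), exists a, good q.1 q.2 ->
    good q.1.+1 (upd q.1 q.2 a).
  move=> [n p]; have [gp|ngp] := pselect (good n p); last by exists 0%N.
  by have [a ga] := step n p gp; exists a.
pose p := fix p n := if n is m.+1 then upd m (p m) (A (m, p m)) else fun=> 0%N.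
have gp n : good n (p n).
  elim: n => [k|n IH]; last exact: (AP (n, p n) IH).
  by have [c [cb Qc]] := Qex k; exists c.
have pS m n i : (i < n)%N -> p (m + n)%N i = p n i.
  elim: m => // m IH ilt; rewrite addSn /= /upd (ltn_eqF _) ?IH//.
  exact: ltn_addl.
exists (fun i => p i.+1 i) => k.
have [c [_ pc Qc]] := gp k k; apply: Qa Qc => i ik.
by rewrite -pc// -(subnK ik) pS.
Qed.

Section Chains.
Variables (H : (nat -> bool) -> (nat -> bool) -> (nat -> nat) -> Prop).

(* Finite approximations of length k of chains of n steps in the relation coded
   by the closed set H; adding 1 for each step makes n bounded by s 0. *)
Fixpoint chain (n k : nat) (u v : nat -> bool) (s : nat -> nat) : Prop :=
  if n is m.+1 then
    exists v' t x y d, [/\ chain m k u v' t, agree k x v', agree k y v, H x y d &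
      agree k s (fun i => t i + (d i).+1)%N]
  else agree k u v /\ agree k s (fun=> 0%N).

Lemma chain_agree n k u u' v v' s s' : agree k u u' -> agree k v v' -> agree k s s' ->
  chain n k u v s -> chain n k u' v' s'.
Proof.
elim: n u u' v v' s s' => [|n IH] u u' v v' s s' uu' vv' ss'.
  move=> [uv s0]; split; last exact: agree_trans (agree_sym ss') s0.
  exact: agree_trans (agree_trans (agree_sym uu') uv) vv'.
move=> [v1 [t [x [y [d [c xv yv Hxy sd]]]]]]; exists v1, t, x, y, d; split => //.
- exact: IH c.
- exact: agree_trans yv vv'.
- exact: agree_trans (agree_sym ss') sd.
Qed.

Lemma chain_le n k l u v s : (k <= l)%N -> chain n l u v s -> chain n k u v s.
Proof.
move=> kl; elim: n v s => [|n IH] v s.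
  by move=> [uv s0]; split; exact: agree_le kl _.
move=> [v1 [t [x [y [d [/IH c xv yv Hxy sd]]]]]]; exists v1, t, x, y, d.
by split => //; exact: agree_le kl _.
Qed.

Lemma chain_trans n m k u v w s t : chain n k u v s -> chain m k v w t ->
  chain (m + n) k u w (fun i => s i + t i)%N.
Proof.
move=> cn; elim: m w t => [|m IH] w t.
  move=> [vw t0]; apply: chain_agree cn => // i ik.
  by rewrite t0// addn0.
move=> [v1 [t' [x [y [d [/IH c xv yv Hxy sd]]]]]].
exists v1, (fun i => s i + t' i)%N, x, y, d; split => // i ik.
by rewrite sd// addnA.
Qed.

Lemma chain_bound n k u v s : (0 < k)%N -> chain n k u v s -> (n <= s 0)%N.
Proof.
move=> k0; elim: n v s => // n IH v s [v1 [t [x [y [d [/IH c _ _ _ sd]]]]]].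
by rewrite sd//; lia.
Qed.

Variables (X : Type) (P : X -> X -> Prop) (phi : X -> nat -> bool).
Hypotheses (phiI : injective phi) (cH : closed_rel3 H)
  (HP : forall x y d, H x y d -> exists z w, [/\ x = phi z, y = phi w & P z w])
  (Ptrans : forall x y z, P x y -> P y z -> P x z).

(** Induction on [n], peeling off the last step. Its intermediate point and the sum before it are
    bounded in terms of [s], so compactness finds one choice valid for all [k]; as [H] is closed,
    the last step then holds exactly, and transitivity joins it to the rest. The alternative [x = y]
    is the empty chain. *)
Lemma chain_limit n x y s : (forall k, chain n k x y s) ->
  x = y \/ exists z w, [/\ x = phi z, y = phi w & P z w].
Proof.
elim: n y s => [|n IH] y s cs.
  by left; apply/funext => i; have [xy _] := cs i.+1; exact: xy.
(* [c] codes both unknowns: its parity is the intermediate point, its half the sum before the last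
   step. That sum is below [s], whence the bound [2 * s i + 1]. *)
pose Q k (c : nat -> nat) := exists x' y' d, [/\ chain n k x (odd \o c) (half \o c),
  agree k x' (odd \o c), agree k y' y, H x' y' d & agree k s (fun i => (c i)./2 + (d i).+1)%N].
have [||k|c cQ] := @koenig (fun i => (s i).*2.+1) Q.
- move=> k c c' cc' [x' [y' [d [ch xv yv Hxy sd]]]]; exists x', y', d.
  have cc1 : agree k (odd \o c) (odd \o c') by move=> i ik /=; rewrite cc'.
  split=> //.
  + by apply: chain_agree ch => // i ik /=; rewrite cc'.
  + exact: agree_trans xv cc1.
  + by move=> i ik; rewrite -cc'// sd.
- move=> k c [x' [y' [d [ch xv yv Hxy sd]]]]; exists x', y', d.
  split=> //; [exact: chain_le ch|exact: agree_le xv|exact: agree_le yv|exact: agree_le sd].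
- have [v' [t [x' [y' [d [ch xv yv Hxy sd]]]]]] := cs k.
  pose c i := if (i < k)%N then (v' i + (t i).*2)%N else 0%N.
  have cv : agree k v' (odd \o c).
    by move=> i ik; rewrite /= /c ik oddD odd_double addbF; case: (v' i).
  have ct : agree k t (half \o c).
    by move=> i ik; rewrite /= /c ik half_bit_double.
  exists c; split.
    by move=> i; rewrite /c; case: ifP => // ik; rewrite sd//; case: (v' i); lia.
  exists x', y', d; split => //.
  + exact: chain_agree ch.
  + exact: agree_trans xv cv.
  + by move=> i ik; rewrite sd//= ct.
have [x' [y' [d [_ _ _ /HP[z [w [xz yw zw]]] _]]]] := cQ 0%N.
(* In the limit the last witness is the difference of the two sums, less the 1 counted for each
   step. *)
have Hc : H (odd \o c) y (fun i => s i - (c i)./2 - 1)%N.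
  apply: cH => k; have [x1 [y1 [d1 [_ xv yv Hxy sd]]]] := cQ k.
  exists x1, y1, d1; split=> // i ik.
  by rewrite sd//; lia.
have [z1 [w1 [oz yw1 zw1]]] := HP Hc.
have [|xo|[z2 [w2 [xz2 ow2 zw2]]]] := IH (odd \o c) (half \o c).
- by move=> k; have [x1 [y1 [d1 [ch _ _ _ _]]]] := cQ k.
- by right; exists z1, w1; rewrite xo.
- right; exists z2, w1; split=> //; apply: Ptrans zw2 _.
  by have -> : w2 = z1 by apply: phiI; rewrite -ow2.
Qed.

Definition chain_approx k u v s := exists n, chain n k u v s.

(** The number of steps may depend on [k], but it is at most [s 0]. If each such number failed at
    some length, there would be no chain of a length beyond all of these. *)
Lemma chain_approx_limit (Prefl : forall x, P x x) z w s :
  (forall k, chain_approx k (phi z) (phi w) s) -> P z w.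
Proof.
move=> ap.
have [n cn] : exists n, forall k, chain n k (phi z) (phi w) s.
  apply: contrapT => /forallNP nc.
  have /choice[K KP] : forall n, exists k, ~ chain n k (phi z) (phi w) s.
    by move=> n; have /existsNP := nc n.
  have [n cn] := ap (\max_(n < (s 0%N).+1) K n).+1.
  have nlt : (n < (s 0%N).+1)%N by rewrite ltnS (chain_bound _ cn).
  apply: (KP n); apply: chain_le cn; rewrite leqW//.
  exact: (@leq_bigmax _ (fun n : 'I_(s 0%N).+1 => K n) (Ordinal nlt)).
have [/phiI ->//|[z1 [w1 [/phiI -> /phiI -> ]]]//] := chain_limit cn.
Qed.

End Chains.

(** * Unconditional bases from solid families of functionals *)

Section SolidBasis.
Variables (R : realType) (Phi : (nat -> R) -> Prop).
Hypotheses (Phi_solid : forall f g : nat -> R, Phi f -> (forall i, `|g i| <= `|f i|) -> Phi g)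
  (Phi_unit : forall i : nat, Phi (fun j => (j == i)%:R))
  (Phi_le1 : forall f i, Phi f -> `|f i| <= 1).

(** Vectors will be bounded functions on this type, so that the norm of a finite sum is the supremum
    of its absolute pairings with the members of [Phi]. *)
Definition functional := {f : nat -> R | Phi f}.

Fact basis_vec_subproof (i : nat) :
  (fun f : functional => sval f i) \in @linf_pred R functional.
Proof. by apply/asboolP; exists 1 => -[f Pf]; exact: Phi_le1. Qed.

Definition basis_vec (i : nat) : linf R functional := Linf (basis_vec_subproof i).

Lemma basis_sumE (a : nat -> R) F (P : pred nat) f (Pf : Phi f) :
  (\sum_(j <- F | P j) a j *: basis_vec j) (exist _ f Pf) = \sum_(j <- F | P j) a j * f j.
Proof. by rewrite linf_sumE; apply: eq_bigr. Qed.

Lemma basis_sum_ge (a : nat -> R) F (P : pred nat) f : Phi f ->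
  `|\sum_(j <- F | P j) a j * f j| <= `|\sum_(j <- F | P j) a j *: basis_vec j|.
Proof. by move=> Pf; rewrite -(basis_sumE a F P Pf); exact: linf_norm_ub. Qed.

Lemma basis_sum_le (a : nat -> R) F (P : pred nat) M : 0 <= M ->
  (forall f, Phi f -> `|\sum_(j <- F | P j) a j * f j| <= M) ->
  `|\sum_(j <- F | P j) a j *: basis_vec j| <= M.
Proof. by move=> M0 H; apply: linf_norm_le => // -[f Pf]; rewrite basis_sumE H. Qed.

Lemma basis_sum_comp_ge (a : nat -> R) F (h : nat -> nat) f : Phi f ->
  `|\sum_(j <- F) a j * f (h j)| <= `|\sum_(j <- F) a j *: basis_vec (h j)|.
Proof.
move=> Pf; rewrite (_ : \sum_(j <- F) _ =
  (\sum_(j <- F) a j *: basis_vec (h j)) (exist _ f Pf)); first exact: linf_norm_ub.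
by rewrite linf_sumE; apply: eq_bigr.
Qed.

Lemma basis_sum_comp_le (a : nat -> R) F (h : nat -> nat) M : 0 <= M ->
  (forall f, Phi f -> `|\sum_(j <- F) a j * f (h j)| <= M) ->
  `|\sum_(j <- F) a j *: basis_vec (h j)| <= M.
Proof. by move=> M0 H; apply: linf_norm_le => // -[f Pf]; rewrite linf_sumE; exact: (H f). Qed.

(** A functional set to zero off [P] stays in [Phi] by solidity, so every pairing of the smaller sum
    is also a pairing of the larger one. *)
Lemma basis_vec_suppressing : suppressing basis_vec 1.
Proof.
split=> // a F P uF; rewrite mul1r; apply: basis_sum_le => // f Pf.
pose g j := if P j then f j else 0.
have Pg : Phi g.
  by apply: Phi_solid Pf _ => i; rewrite /g; case: ifP => // _; rewrite normr0.
rewrite (_ : \sum_(j <- F | P j) a j * f j = \sum_(j <- F) a j * g j).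
  exact: basis_sum_ge.
by rewrite big_mkcond; apply: eq_bigr => j _; rewrite /g; case: ifP; rewrite ?mulr0.
Qed.

Let coef (y : linf R functional) i := y (exist _ _ (Phi_unit i)).

Lemma basis_coef_sum (a : nat -> R) (n i : nat) :
  coef (\sum_(j < n) a j *: basis_vec j) i = if (i < n)%N then a i else 0.
Proof.
rewrite -(big_mkord xpredT (fun j => a j *: basis_vec j)) /coef basis_sumE.
have [ilt|ni] := ltnP i n; last first.
  rewrite big_nat big1// => j /andP[_ jn].
  by rewrite ltn_eqF ?mulr0// (leq_trans jn ni).
rewrite (bigD1_seq i) ?mem_index_iota ?iota_uniq//= eqxx mulr1 big1 ?addr0//.
by move=> j /negbTE ->; rewrite mulr0.
Qed.

(** For finite combinations one truncates the functional; the bound passes to the closure because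
    coefficients depend continuously on the vector. *)
Lemma closed_span_partial_sum y m f : closed_span basis_vec y -> Phi f ->
  `|\sum_(0 <= i < m) coef y i * f i| <= `|y|.
Proof.
move=> cy Pf; apply/ler_addgt0Pr => e e0.
(* The [m] coefficients and the norm itself each change by at most [d], in total [e]. *)
pose d := e / (m.+1%:R); have d0 : 0 < d by rewrite divr_gt0.
have [y' [[n [a y'E]] yy']] := cy _ (nbhsx_ballx y _ d0).
rewrite -ball_normE/= in yy'.
have h1 : `|\sum_(0 <= i < m) (coef y i - coef y' i) * f i| <= m%:R * d.
  rewrite (le_trans (ler_norm_sum _ _ _))//.
  rewrite [leRHS](_ : _ = \sum_(0 <= i < m) d); last first.
    by rewrite sumr_const_nat subn0 mulr_natl.
  apply: ler_sum => i _; rewrite normrM -[leRHS]mulr1 ler_pM ?Phi_le1//.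
  exact: le_trans (linf_norm_ub (y - y') _) (ltW yy').
have h2 : `|\sum_(0 <= i < m) coef y' i * f i| <= `|y'|.
  pose g i := if (i < m)%N then f i else 0.
  have Pg : Phi g.
    by apply: Phi_solid Pf _ => i; rewrite /g; case: ifP => // _; rewrite normr0.
  rewrite (_ : \sum_(0 <= i < m) _ = y' (exist _ _ Pg)); first exact: linf_norm_ub.
  rewrite (eq_bigr (fun i => if (i < n)%N then a i * f i else 0)); last first.
    by move=> i _; rewrite y'E basis_coef_sum; case: ifP; rewrite ?mul0r.
  rewrite [in RHS]y'E -(big_mkord xpredT (fun j => a j *: basis_vec j)) basis_sumE.
  rewrite [RHS](eq_bigr (fun i => if (i < m)%N then a i * f i else 0)); last first.
    by move=> i _; rewrite /g; case: ifP; rewrite ?mulr0.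
  rewrite -!big_mkcond/=.
  have [nm|/ltnW mn] := leqP n m.
    rewrite -(big_nat_widen _ _ _ xpredT _ nm) [RHS]big_nat_cond [LHS]big_nat_cond.
    apply: eq_bigl => i; rewrite !andbT; case: (ltnP i n) => //= ilt.
    by rewrite (leq_trans ilt nm).
  rewrite -(big_nat_widen _ _ _ xpredT _ mn) [RHS]big_nat_cond [LHS]big_nat_cond.
  apply: eq_bigl => i; rewrite !andbT; case: (ltnP i m) => //= ilt.
  by rewrite (leq_trans ilt mn).
have -> : \sum_(0 <= i < m) coef y i * f i =
    \sum_(0 <= i < m) (coef y i - coef y' i) * f i + \sum_(0 <= i < m) coef y' i * f i.
  by rewrite -big_split; apply: eq_bigr => i _; rewrite /= -mulrDl subrK.
have h3 : `|y'| <= `|y| + d.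
  have := ler_normB y (y - y'); rewrite opprB addrC subrK => /le_trans; apply.
  by rewrite lerD2l ltW.
have h4 : e = m%:R * d + d by rewrite /d -natr1; field; rewrite natr1.
by rewrite (le_trans (ler_normD _ _))//; lra.
Qed.

Lemma closed_spanB_finite (V : normedModType R) (x : nat -> V) y n (b : nat -> R) :
  closed_span x y -> closed_span x (y - \sum_(i < n) b i *: x i).
Proof.
move=> cy; set s := \sum_(i < n) _ => U Us.
have : nbhs y ((fun z => z - s) @^-1` U).
  have : continuous (fun z : V => z - s).
    by move=> z; apply: cvgB; [exact: cvg_id|exact: cvg_cst].
  exact.
move=> /cy[y' [[m [a y'E]] Uy']]; exists (y' - s); split=> //.
exists (maxn m n), (fun i => (if (i < m)%N then a i else 0) - (if (i < n)%N then b i else 0)).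
have pad k (c : nat -> R) : (k <= maxn m n)%N ->
    \sum_(i < k) c i *: x i = \sum_(i < maxn m n) (if (i < k)%N then c i else 0) *: x i.
  move=> kM; rewrite -(big_mkord xpredT (fun i => c i *: x i)).
  rewrite -(big_mkord xpredT (fun i => (if (i < k)%N then c i else 0) *: x i)).
  rewrite (big_nat_widen _ _ _ _ _ kM) big_mkcond; apply: eq_bigr => i _ /=.
  by case: ifP; rewrite ?scale0r.
rewrite y'E /s (pad m a (leq_maxl _ _)) (pad n b (leq_maxr _ _)) -sumrB.
by apply: eq_bigr => i _; rewrite scalerBl.
Qed.

Lemma basis_vec_basic : basic_seq basis_vec.
Proof.
move=> y cy; exists (coef y); split.
  apply/cvgrPdist_le => e e0.
  have d0 : 0 < e / 2 by rewrite divr_gt0.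
  have [y' [[n [a y'E]] yy']] := cy _ (nbhsx_ballx y _ d0).
  rewrite -ball_normE/= in yy'.
  exists n => // m /= nm; rewrite distrC.
  have coefB i : coef (y - y') i = coef y i - coef y' i by [].
  have y'm : \sum_(0 <= i < m) coef y' i *: basis_vec i = y'.
    rewrite {2}y'E -(big_mkord xpredT (fun i => a i *: basis_vec i)).
    rewrite (big_nat_widen _ _ _ _ _ nm) [RHS]big_mkcond; apply: eq_bigr => i _ /=.
    by rewrite y'E basis_coef_sum; case: ifP; rewrite ?scale0r.
  have -> : series (fun i => coef y i *: basis_vec i) m - y =
     \sum_(0 <= i < m) coef (y - y') i *: basis_vec i - (y - y').
    under [in RHS]eq_bigr do rewrite coefB scalerBl.
    by rewrite sumrB y'm opprB addrA subrK.
  rewrite (le_trans (ler_normB _ _))// (splitr e) lerD ?(ltW yy')//.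
  apply: basis_sum_le => [|f Pf]; first exact: ltW.
  apply: le_trans (ltW yy'); apply: closed_span_partial_sum => //.
  by rewrite y'E; exact: closed_spanB_finite.
move=> b by_; apply/funext => i.
apply/eqP; rewrite -subr_eq0 -normr_le0; apply/ler_addgt0Pr => e e0; rewrite add0r.
have /cvgrPdist_le/(_ _ e0)[N _ NP] := by_.
have := NP (maxn N i.+1) (leq_maxl _ _); set M := maxn N i.+1.
apply: le_trans; rewrite -[b i](_ : coef (series (fun i => b i *: basis_vec i) M) i = _).
  exact: (linf_norm_ub (y - _) _).
by rewrite /series/= big_mkord basis_coef_sum leq_maxr.
Qed.

Lemma basis_vec_uncond_basic : uncond_basic_seq basis_vec.
Proof.
split=> [|a ca s bs]; first exact: basis_vec_basic.
have sI := bij_inj bs.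
apply: uncond_cauchy_converges; rewrite (uncond_cauchy_extend0 _ _ sI).
rewrite (_ : extend0 _ _ = a); first exact: suppressing_uncond_cauchy basis_vec_suppressing ca.
by apply/funext => j; have [g gK Kg] := bs; rewrite -(Kg j) extend0E.
Qed.

End SolidBasis.

(** * The node space *)

(** Each chosen [x n] has one colour [b n] with all members of the next infinite set; then the
    indices with one infinitely recurring colour are kept. *)
Lemma ramsey_pairs (c : nat -> nat -> bool) : exists (r : nat -> nat) (b : bool),
  increasing_nat r /\ forall i j, (i < j)%N -> c (r i) (r j) = b.
Proof.
pose inf (A : nat -> Prop) := forall n, exists m, (n <= m)%N /\ A m.
have step A : inf A -> exists q : nat * bool * (nat -> Prop),
    [/\ A q.1.1, inf q.2 & forall m, q.2 m -> [/\ A m, (q.1.1 < m)%N & c q.1.1 m = q.1.2]].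
  move=> iA; have [x [_ Ax]] := iA 0%N.
  have [it|nt] := pselect (inf (fun m => [/\ A m, (x < m)%N & c x m = true])).
    by exists (x, true, fun m => [/\ A m, (x < m)%N & c x m = true]).
  exists (x, false, fun m => [/\ A m, (x < m)%N & c x m = false]); split => // n.
  move: nt => /existsNP[k /forallNP nk].
  have [m [+ Am]] := iA (maxn (maxn n k) x.+1).
  rewrite !geq_max => /andP[/andP[nm km] xm]; exists m; split => //; split=> //.
  by apply/negbTE/negP => cx; apply: (nk m).
have /choice[G GP] : forall A, exists q : nat * bool * (nat -> Prop), inf A ->
    [/\ A q.1.1, inf q.2 & forall m, q.2 m -> [/\ A m, (q.1.1 < m)%N & c q.1.1 m = q.1.2]].
  move=> A; have [/step[q qP]|nA] := pselect (inf A); first by exists q.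
  by exists (0%N, true, A).
pose S := fix S n := if n is m.+1 then (G (S m)).2 else fun=> True.
have iS n : inf (S n).
  elim: n => [n|n IH] /=; first by exists n.
  by have [] := GP _ IH.
pose x n := (G (S n)).1.1; pose b n := (G (S n)).1.2.
have Sx n m : S n.+1 m -> [/\ S n m, (x n < m)%N & c (x n) m = b n].
  by have [_ _] := GP _ (iS n); apply.
have Sle n k m : S (k + n)%N m -> S n m.
  by elim: k => // k IH; rewrite addSn => /Sx[/IH].
have xS n : S n (x n) by have [] := GP _ (iS n).
have xc i j : (i < j)%N -> (x i < x j)%N /\ c (x i) (x j) = b i.
  move=> ij; have : S i.+1 (x j) by apply: (Sle _ (j - i.+1)%N); rewrite subnK.
  by move=> /Sx[_ h1 h2].
have [be ibe] : exists be, inf_subset_nat (fun m => b m == be).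
  have [it|nt] := pselect (inf_subset_nat (fun m => b m == true)); first by exists true.
  exists false => n; move: nt => /existsNP[k /forallNP nk].
  exists (maxn n k); split; first exact: leq_maxl.
  apply/eqP/negbTE/negP => bk; apply: (nk (maxn n k)).
  by rewrite leq_maxr bk.
pose r := enum_inc (fun m => b m == be).
have ri : increasing_nat r by exact: enum_inc_increasing.
exists (x \o r), be; split=> [i|i j ij] /=; first by have [] := xc _ _ (ri i).
have [_ ->] := xc _ _ (increasing_nat_lt ri ij).
exact/eqP/(enum_inc_mem ibe).
Qed.

Lemma ramsey_trichotomy (T : eqType) (rel : T -> T -> bool) (t : nat -> T) :
  exists r, increasing_nat r /\
  [\/ exists s, forall i, t (r i) = s,
      forall i j, (i < j)%N -> t (r i) != t (r j) /\ rel (t (r i)) (t (r j)) |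
      forall i j, (i < j)%N -> t (r i) != t (r j) /\ ~~ rel (t (r i)) (t (r j))].
Proof.
have [r [[] [ri rP]]] := ramsey_pairs (fun i j => t i == t j).
  exists r; split=> //; apply: Or31; exists (t (r 0%N)) => -[//|i].
  by rewrite (eqP (rP 0%N i.+1 _)).
have [r' [b [ri' rP']]] := ramsey_pairs (fun i j => rel (t (r i)) (t (r j))).
exists (r \o r'); split; first by move=> i; exact: (increasing_nat_lt ri (ri' i)).
case: b rP' => rP'; [apply: Or32|apply: Or33] => i j ij; rewrite /= rP' //; split=> //;
  by rewrite rP//; exact: increasing_nat_lt.
Qed.

(** Covers injections that are not increasing: the sum along [h] is an initial sum whose
    coefficients are padded with zeros. *)
Lemma dominated_comp (R : realType) (V W : normedModType R) (y : nat -> W) (x : nat -> V) C h :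
  injective h -> dominated y x C -> dominated (y \o h) (x \o h) C.
Proof.
move=> hI dyx a n; pose M := (\max_(i < n) h i).+1.
have E (U : lmodType R) (z : nat -> U) : \sum_(0 <= i < n) a i *: (z \o h) i =
    \sum_(0 <= j < M) (if j \in map h (iota 0 n) then extend0 h a j else 0) *: z j.
  rewrite [LHS](extend0_sum a z (index_iota 0 n) xpredT hI) /index_iota subn0.
  rewrite [RHS](eq_bigr (fun j => if j \in map h (iota 0 n) then extend0 h a j *: z j else 0)).
    rewrite -big_mkcond -[RHS]big_filter; apply: perm_big; apply: uniq_perm.
    - by rewrite map_inj_uniq// iota_uniq.
    - by rewrite filter_uniq// iota_uniq.
    move=> j; rewrite mem_filter mem_iota/= add0n subn0.
    case: (boolP (j \in _)) => //= /mapP[i + ->]; rewrite mem_iota/= => ilt.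
    by rewrite ltnS (@leq_bigmax _ (fun i : 'I_n => h i) (Ordinal ilt)).
  by move=> j _; case: ifP; rewrite ?scale0r.
by rewrite !E; exact: dyx.
Qed.

Lemma powRD_gt0 (R : realType) (x p q : R) : 0 < x -> x `^ (p + q) = x `^ p * x `^ q.
Proof. by move=> x0; rewrite powRD//; apply/implyP => _; rewrite gt_eqF. Qed.

Lemma powR_growth (R : realType) (p q C : R) : 0 < C ->
  (forall n : nat, (0 < n)%N -> n%:R `^ q <= C * n%:R `^ p) -> q <= p.
Proof.
move=> C0 H; rewrite leNgt; apply/negP => pq.
have r0 : 0 < q - p by rewrite subr_gt0.
(* Chosen so that [n] to the power [q - p] exceeds [C]. *)
pose n := (Num.trunc (C `^ (q - p)^-1)).+1.
have n0 : 0 < (n%:R : R) by rewrite ltr0n.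
have Cn : C `^ (q - p)^-1 < n%:R by exact: truncnS_gt.
have : C < n%:R `^ (q - p).
  have := gt0_ltr_powR r0 _ _ Cn; rewrite -powRrM mulVf ?gt_eqF// powRr1 ?ltW//.
  by apply; rewrite nnegrE ?powR_ge0// ltW.
have e : n%:R `^ q = n%:R `^ (q - p) * n%:R `^ p by rewrite -powRD_gt0 ?subrK.
by have := H n isT; rewrite e ler_pM2r ?powR_gt0// leNgt => /negP.
Qed.

Section NodeSpace.
Variable R : realType.

Notation node := (seq (bool * nat)).

(** An index codes a node and a multiplicity, so every node carries infinitely many indices; a
    number that decodes to nothing goes to the root. *)
Definition node_of (n : nat) : node := (odflt ([::], 0)%N (unpickle n)).1.

Lemma node_of_pickle (s : node) (n : nat) : node_of (pickle (s, n)) = s.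
Proof. by rewrite /node_of pickleK. Qed.

Definition comparable_nodes (s t : node) := prefix s t || prefix t s.

(** Lies strictly between 0 and 1, depends only on the bits of the node, and determines them because
    [pickle] is injective. *)
Definition node_exponent (s : node) : R := (pickle (unzip1 s)).+2%:R^-1.

Lemma node_exponent_gt0 s : 0 < node_exponent s.
Proof. by rewrite invr_gt0 ltr0n. Qed.

Lemma node_exponent_lt1 s : node_exponent s < 1.
Proof. by rewrite invf_lt1 ?ltr0n// ltr1n. Qed.

Lemma node_exponent_inj s t : node_exponent s = node_exponent t -> unzip1 s = unzip1 t.
Proof.
move=> /invr_inj/eqP; rewrite eqr_nat => /eqP[]; exact: (pcan_inj (@pickleK _)).
Qed.

(** If [F] has [m] indices at a node of exponent [q], each gets weight [m^(q-1)], so their sum pairs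
    to [m^q], the intended fundamental function. *)
Definition node_weight (F : seq nat) (i : nat) : R :=
  if i \in F then
    ((count (fun j => node_of j == node_of i) F)%:R `^ (1 - node_exponent (node_of i)))^-1
  else 0.

(** Confining supports to chains of nodes makes vectors at distinct nodes of a branch behave like
    l_1 and vectors on an antichain like c_0. *)
Definition chain_functional (f : nat -> R) : Prop := exists F : seq nat,
  [/\ uniq F, {in F &, forall i j, comparable_nodes (node_of i) (node_of j)} &
   forall i, `|f i| <= node_weight F i].

Lemma node_count_gt0 F i : i \in F -> (0 < count (fun j => node_of j == node_of i) F)%N.
Proof. by move=> iF; rewrite -has_count; apply/hasP; exists i. Qed.

Lemma node_weight_ge0 F i : 0 <= node_weight F i.
Proof. by rewrite /node_weight; case: ifP => // _; rewrite invr_ge0 powR_ge0. Qed.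

Lemma node_weight_le1 F i : node_weight F i <= 1.
Proof.
rewrite /node_weight; case: ifP => // /node_count_gt0 c0.
have c1 : 1 <= (count (fun j => node_of j == node_of i) F)%:R `^ (1 - node_exponent (node_of i)).
  rewrite -[leLHS](_ : 1 `^ (1 - node_exponent (node_of i)) = 1); last by rewrite powR1.
  apply: ge0_ler_powR.
  - by rewrite subr_ge0 ltW// node_exponent_lt1.
  - by rewrite nnegrE.
  - by rewrite nnegrE.
  - by rewrite ler1n.
by rewrite invf_le1// (lt_le_trans ltr01).
Qed.

Lemma chain_functional_solid (f g : nat -> R) : chain_functional f ->
  (forall i, `|g i| <= `|f i|) -> chain_functional g.
Proof.
by move=> [F [uF cF fF]] gf; exists F; split=> // i; exact: le_trans (gf i) (fF i).
Qed.

Lemma chain_functional_weight F : uniq F ->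
  {in F &, forall i j, comparable_nodes (node_of i) (node_of j)} ->
  chain_functional (node_weight F).
Proof. by move=> uF cF; exists F; split=> // i; rewrite ger0_norm// node_weight_ge0. Qed.

Lemma chain_functional_unit i : chain_functional (fun j => (j == i)%:R).
Proof.
exists [:: i]; split=> // [a b|j].
  by rewrite !inE => /eqP -> /eqP ->; rewrite /comparable_nodes prefix_refl.
rewrite /node_weight inE; case: (eqVneq j i) => [->|_]; last by rewrite normr0.
by rewrite /= eqxx powR1 invr1 normr1.
Qed.

Lemma chain_functional_le1 f i : chain_functional f -> `|f i| <= 1.
Proof. by move=> [F [_ _ fF]]; exact: le_trans (fF i) (node_weight_le1 _ _). Qed.

Definition node_basis : nat -> linf R (functional chain_functional) :=
  @basis_vec R chain_functional chain_functional_le1.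

Lemma node_basis_uncond_basic : uncond_basic_seq node_basis.
Proof.
exact: (basis_vec_uncond_basic chain_functional_solid chain_functional_unit).
Qed.

Lemma node_basis_suppressing : suppressing node_basis 1.
Proof. exact: (basis_vec_suppressing chain_functional_solid). Qed.

Lemma node_basis_map (h : nat -> nat) n :
  \sum_(0 <= i < n) (1 : R) *: node_basis (h i)
  = \sum_(j <- map h (iota 0 n)) (1 : R) *: node_basis j.
Proof. by rewrite big_map /index_iota subn0. Qed.

(** * Norms of sums of [n] basis vectors *)

Section Estimates.
Variables (h : nat -> nat).
Hypothesis hI : injective h.

Let L n := map h (iota 0 n).
Let uL n : uniq (L n). Proof. by rewrite map_inj_uniq// iota_uniq. Qed.
Let sL n : size (L n) = n. Proof. by rewrite size_map size_iota. Qed.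

(** If [k] of the vectors meet a functional with [m] indices at [s], then [k <= m], and the pairing
    is at most [k / m^(1-q) <= k^q <= n^q]. *)
Lemma node_basis_const_le s n : (forall i, node_of (h i) = s) ->
  `|\sum_(0 <= i < n) (1 : R) *: node_basis (h i)| <= n%:R `^ node_exponent s.
Proof.
move=> hs; rewrite node_basis_map; apply: basis_sum_le; first exact: powR_ge0.
move=> f [F [uF cF fF]]; rewrite -/(L n).
pose m := count (fun j => node_of j == s) F.
pose k := count (mem F) (L n).
have wE j : j \in L n -> node_weight F j =
    if j \in F then (m%:R `^ (1 - node_exponent s))^-1 else 0.
  by move=> /mapP[i _ ->]; rewrite /node_weight hs.
have le1 : `|\sum_(j <- L n) 1 * f j| <= k%:R * (m%:R `^ (1 - node_exponent s))^-1.
  rewrite (le_trans (ler_norm_sum _ _ _))//.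
  rewrite (@le_trans _ _ (\sum_(j <- L n) node_weight F j))//.
    by apply: ler_sum => j _; rewrite mul1r.
  rewrite (eq_big_seq _ wE) -big_mkcond/= big_const_seq iter_addr_0.
  by rewrite -[leLHS]mulr_natl.
apply: (le_trans le1).
have km : (k <= m)%N.
  rewrite /k /m -!size_filter; apply: uniq_leq_size; first by rewrite filter_uniq.
  move=> j; rewrite !mem_filter => /andP[/= jF /mapP[i _ ji]].
  by rewrite jF ji hs eqxx.
have kn : (k <= n)%N by rewrite -(sL n); exact: count_size.
have [->|k0] := posnP k; first by rewrite mul0r powR_ge0.
have kR : 0 < (k%:R : R) by rewrite ltr0n.
have e1 : 0 <= 1 - node_exponent s by rewrite subr_ge0 ltW// node_exponent_lt1.
apply: (@le_trans _ _ (k%:R `^ node_exponent s)); last first.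
  apply: ge0_ler_powR; rewrite ?nnegrE ?ler_nat//.
  exact/ltW/node_exponent_gt0.
rewrite ler_pdivrMr; last by rewrite powR_gt0// ltr0n (leq_trans k0).
have e : k%:R = k%:R `^ node_exponent s * k%:R `^ (1 - node_exponent s).
  by rewrite -powRD_gt0// subrKC powRr1// ltW.
rewrite {1}e ler_pM2l ?powR_gt0//.
by apply: ge0_ler_powR; rewrite ?nnegrE ?ler_nat.
Qed.

(** Test against the functional supported on exactly these vectors. *)
Lemma node_basis_const_ge s n : (forall i, node_of (h i) = s) ->
  n%:R `^ node_exponent s <= `|\sum_(0 <= i < n) (1 : R) *: node_basis (h i)|.
Proof.
move=> hs; rewrite node_basis_map -/(L n).
have cL : {in L n &, forall i j, comparable_nodes (node_of i) (node_of j)}.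
  move=> i j /mapP[i' _ ->] /mapP[j' _ ->].
  by rewrite !hs /comparable_nodes prefix_refl.
have := basis_sum_ge chain_functional_le1 (fun=> 1) (L n) xpredT
  (chain_functional_weight (uL n) cL).
apply: le_trans; apply: le_trans (ler_norm _).
rewrite (eq_big_seq (fun=> (n%:R `^ (1 - node_exponent s))^-1)); last first.
  move=> j jL; rewrite mul1r /node_weight jL; have /mapP[i _ ->] := jL; rewrite hs.
  congr ((_%:R `^ _)^-1); rewrite -[RHS](sL n); apply/eqP; rewrite -all_count.
  by apply/allP => _ /mapP[i' _ ->]; rewrite hs.
rewrite big_const_seq iter_addr_0 count_predT sL.
have [->|n0] := posnP n.
  by rewrite mulr0n powR0// gt_eqF// node_exponent_gt0.
have nR : 0 < (n%:R : R) by rewrite ltr0n.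
rewrite -[leRHS]mulr_natl ler_pdivlMr ?powR_gt0// -powRD_gt0// subrKC powRr1// ltW.
Qed.

(** On distinct nodes every count is 1, so the functional supported on these vectors has all weights
    1. *)
Lemma node_basis_chain_ge n :
  (forall i j, (i < j)%N -> node_of (h i) != node_of (h j) /\
     comparable_nodes (node_of (h i)) (node_of (h j))) ->
  n%:R <= `|\sum_(0 <= i < n) (1 : R) *: node_basis (h i)|.
Proof.
move=> hc; rewrite node_basis_map -/(L n).
have cL : {in L n &, forall i j, comparable_nodes (node_of i) (node_of j)}.
  move=> _ _ /mapP[i _ ->] /mapP[j _ ->]; case: (ltngtP i j) => [/hc[]//|/hc[_]|->].
    by rewrite /comparable_nodes orbC.
  by rewrite /comparable_nodes prefix_refl.
have := basis_sum_ge chain_functional_le1 (fun=> 1) (L n) xpredT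
  (chain_functional_weight (uL n) cL).
apply: le_trans; apply: le_trans (ler_norm _).
rewrite (eq_big_seq (fun=> 1)); last first.
  move=> j jL; rewrite mul1r /node_weight jL.
  rewrite (_ : count _ _ = 1%N) ?powR1 ?invr1//.
  transitivity (count_mem j (L n)); last by rewrite count_uniq_mem ?jL ?uL.
  apply: eq_in_count => k kL /=.
  have /mapP[i _ ->] := jL; have /mapP[l _ ->] := kL.
  rewrite (inj_eq hI); case: (ltngtP l i) => [|/hc[/negbTE + _]|->]; last by rewrite !eqxx.
    by move=> /hc[/negbTE -> _].
  by rewrite eq_sym => ->.
by rewrite big_const_seq iter_addr_0 count_predT sL.
Qed.

(** The chain supporting a functional meets an antichain in at most one index, where the value is at
    most 1. *)
Lemma node_basis_antichain_le n :
  (forall i j, (i < j)%N -> ~~ comparable_nodes (node_of (h i)) (node_of (h j))) ->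
  `|\sum_(0 <= i < n) (1 : R) *: node_basis (h i)| <= 1.
Proof.
move=> ha; rewrite node_basis_map -/(L n); apply: basis_sum_le => // f Pf.
have [F [uF cF fF]] := Pf.
rewrite (bigID (mem F))/= [X in _ + X]big1 ?addr0; last first.
  move=> j jF; apply/eqP; rewrite mul1r -normr_le0; apply: le_trans (fF j) _.
  by rewrite /node_weight (negbTE jF).
rewrite -big_filter; set G := [seq _ <- _ | _].
have uG : uniq G by rewrite filter_uniq.
have GP j : j \in G -> exists i, j = h i /\ h i \in F.
  by rewrite mem_filter => /andP[/= jF /mapP[i _ ji]]; exists i; rewrite -ji.
case EG : G => [|x [|y t]]; first by rewrite big_nil normr0.
  by rewrite big_seq1 mul1r chain_functional_le1.
have [i [xi iF]] : exists i, x = h i /\ h i \in F by apply: GP; rewrite EG inE eqxx.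
have [j [yj jF]] : exists i, y = h i /\ h i \in F by apply: GP; rewrite EG !inE eqxx orbT.
move: uG; rewrite EG /= inE negb_or => /andP[/andP[xy _] _]; exfalso.
case: (ltngtP i j) => [/ha|/ha|ij].
- by rewrite cF.
- by rewrite cF.
- by rewrite xi yj ij eqxx in xy.
Qed.

End Estimates.

(** * Constraints on equivalences between sequences of node vectors *)

Section Equivalence.
Variables (g h : nat -> nat) (C : R).
Hypotheses (gI : injective g) (hI : injective h) (C0 : 0 < C)
  (dgh : dominated (node_basis \o g) (node_basis \o h) C)
  (dhg : dominated (node_basis \o h) (node_basis \o g) C).

Let sub_dom (x y : nat -> nat) r n : injective r ->
  dominated (node_basis \o x) (node_basis \o y) C ->
  `|\sum_(0 <= i < n) (1 : R) *: node_basis ((x \o r) i)| <=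
  C * `|\sum_(0 <= i < n) (1 : R) *: node_basis ((y \o r) i)|.
Proof. by move=> rI /(dominated_comp rI)/(_ (fun=> 1) n). Qed.

(** After thinning, the images lie at one node, on a chain or on an antichain, so [n^q] is compared
    with [n^q'], [n] or 1. The last two are impossible for [0 < q < 1]; the first forces equal
    exponents, hence equal labels. *)
Lemma equivalent_node_labels s : (forall i, node_of (g i) = s) ->
  exists i, unzip1 (node_of (h i)) = unzip1 s.
Proof.
move=> gs; apply: contrapT => /forallNP nh.
have [r [ri tri]] := ramsey_trichotomy comparable_nodes (node_of \o h).
have rI := increasing_nat_inj ri.
have grI : injective (g \o r) by exact: inj_comp.
have hrI : injective (h \o r) by exact: inj_comp.
have grs i : node_of ((g \o r) i) = s by rewrite /= gs.
case: tri => [[t ht]|hc|ha].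
- have q1 : node_exponent s <= node_exponent t.
    apply: (powR_growth C0) => n _.
    apply: (le_trans (node_basis_const_ge grI n grs)).
    apply: (le_trans (sub_dom n rI dgh)).
    by rewrite ler_pM2l// node_basis_const_le.
  have q2 : node_exponent t <= node_exponent s.
    apply: (powR_growth C0) => n _.
    apply: (le_trans (node_basis_const_ge hrI n ht)).
    apply: (le_trans (sub_dom n rI dhg)).
    by rewrite ler_pM2l// node_basis_const_le.
  apply: (nh (r 0%N)); rewrite -[node_of _]/((node_of \o h) (r 0%N)) ht.
  by apply: node_exponent_inj; apply/eqP; rewrite eq_le q1 q2.
- have : 1 <= node_exponent s.
    apply: (powR_growth C0) => n _; rewrite powRr1//.
    apply: (le_trans (node_basis_chain_ge hrI n hc)).
    apply: (le_trans (sub_dom n rI dhg)).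
    by rewrite ler_pM2l// node_basis_const_le.
  by rewrite leNgt node_exponent_lt1.
- have : node_exponent s <= 0.
    apply: (powR_growth C0) => n _; rewrite powRr0 mulr1.
    apply: (le_trans (node_basis_const_ge grI n grs)).
    apply: (le_trans (sub_dom n rI dgh)).
    rewrite -[leRHS]mulr1 ler_pM2l// node_basis_antichain_le// => i j ij.
    by have [] := ha i j ij.
  by rewrite leNgt node_exponent_gt0.
Qed.

(** Images forming an antichain would bound norms that grow like [n]. *)
Lemma equivalent_node_chain :
  (forall i j, (i < j)%N -> node_of (g i) != node_of (g j) /\
     comparable_nodes (node_of (g i)) (node_of (g j))) ->
  (forall i j, (i < j)%N -> node_of (h i) != node_of (h j)) ->
  exists r, increasing_nat r /\ forall i j, (i < j)%N ->
    comparable_nodes (node_of (h (r i))) (node_of (h (r j))).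
Proof.
move=> gc hd.
have [r [[] [ri rP]]] := ramsey_pairs (fun i j => comparable_nodes (node_of (h i)) (node_of (h j))).
  by exists r.
have rI := increasing_nat_inj ri.
have grI : injective (g \o r) by exact: inj_comp.
have hrI : injective (h \o r) by exact: inj_comp.
exfalso; have : (1 : R) <= 0.
  apply: (powR_growth C0) => n _; rewrite powRr1// powRr0 mulr1.
  apply: (@le_trans _ _ `|\sum_(0 <= i < n) (1 : R) *: node_basis ((g \o r) i)|).
    by apply: node_basis_chain_ge => // i j ij; apply: gc; exact: increasing_nat_lt.
  apply: (le_trans (sub_dom n rI dgh)).
  rewrite -[leRHS]mulr1 ler_pM2l// node_basis_antichain_le// => i j ij.
  by rewrite /= rP.
by rewrite leNgt ltr01.
Qed.

End Equivalence.

(** * Relabellings of indices that preserve the norm *)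

Section Relabelling.
Variables (F : nat -> nat).
Hypotheses (FI : injective F)
  (Feq : forall i j, (node_of (F i) == node_of (F j)) = (node_of i == node_of j))
  (Fcmp : forall i j, comparable_nodes (node_of (F i)) (node_of (F j)) =
                      comparable_nodes (node_of i) (node_of j))
  (Fexp : forall i, node_exponent (node_of (F i)) = node_exponent (node_of i)).

Lemma chain_functional_push f : chain_functional f ->
  exists f', chain_functional f' /\ forall i, f' (F i) = f i.
Proof.
move=> [L [uL cL fL]]; exists (extend0 F f); split; last by move=> i; rewrite extend0E.
exists (map F L); split; first by rewrite map_inj_uniq.
  by move=> _ _ /mapP[i iL ->] /mapP[j jL ->]; rewrite Fcmp cL.
move=> j; have [Fj|nFj] := eqVneq (F (inj_inv F j)) j; last first.
  by rewrite /extend0 (negbTE nFj) normr0 node_weight_ge0.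
rewrite -Fj extend0E//; move: (inj_inv F j) => i.
rewrite (le_trans (fL i))// /node_weight mem_map//; case: ifP => // _.
rewrite Fexp count_map (@eq_count _ _ (fun k => node_of k == node_of i))// => k /=.
by rewrite Feq.
Qed.

Lemma chain_functional_pull f : chain_functional f -> chain_functional (f \o F).
Proof.
move=> [L [uL cL fL]].
pose L' := [seq inj_inv F j | j <- L & F (inj_inv F j) == j].
have L'P i : (i \in L') = (F i \in L).
  apply/mapP/idP => [[j + ->]|iL].
    by rewrite mem_filter => /andP[/eqP -> ].
  by exists (F i); rewrite ?mem_filter inj_invK// eqxx.
have uL' : uniq L'.
  rewrite map_inj_in_uniq ?filter_uniq// => i j.
  by rewrite !mem_filter => /andP[/eqP hi _] /andP[/eqP hj _] ij; rewrite -hi ij hj.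
exists L'; split=> // [i j|i]; first by rewrite !L'P => iL jL; rewrite -Fcmp cL.
apply: (le_trans (fL _)); rewrite /node_weight L'P; case: ifP => // iL.
have c0 := node_count_gt0 iL.
have iL' : i \in L' by rewrite L'P.
have c0' := node_count_gt0 iL'.
(* Pulling back can only lower the count at a node, hence only raise the weight. *)
rewrite Fexp lef_pV2 ?posrE ?powR_gt0 ?ltr0n//.
apply: ge0_ler_powR; rewrite ?nnegrE ?ler_nat//.
  by rewrite subr_ge0 ltW// node_exponent_lt1.
rewrite -!size_filter -(size_map F); apply: uniq_leq_size.
  by rewrite map_inj_uniq// filter_uniq.
move=> _ /mapP[j + ->]; rewrite !mem_filter => /andP[ji].
by rewrite L'P => ->; rewrite Feq ji.
Qed.

(** Functionals transport in both directions, so [F] induces an isometry and the domination constant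
    is 1. *)
Lemma relabelling_seq_equiv : seq_equiv node_basis (node_basis \o F).
Proof.
move=> a; split; apply: (@dominated_sum_converges _ _ _ _ _ 1) => b n; rewrite mul1r.
  apply: (@basis_sum_comp_le _ _ chain_functional_le1) => // f /chain_functional_pull Pf.
  exact: (@basis_sum_ge _ _ chain_functional_le1 _ _ xpredT _ Pf).
apply: basis_sum_le => // f /chain_functional_push[f' [Pf' ff']].
under eq_bigr do rewrite -ff'.
exact: (basis_sum_comp_ge chain_functional_le1).
Qed.

End Relabelling.

End NodeSpace.

(** * The reduction *)

Section Reduction.
Variables (R : realType) (X : Type) (MX : set (set X)) (P : X -> X -> Prop).
Variables (phi : X -> nat -> bool)
  (H : (nat -> bool) -> (nat -> bool) -> (nat -> nat) -> Prop).
Hypotheses (sMX : is_sigma_algebra MX) (phiI : injective phi)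
  (phiM : forall n b, MX (fun x => phi x n = b)) (cH : closed_rel3 H)
  (PH : forall z w, P z w -> exists d, H (phi z) (phi w) d)
  (HP : forall x y d, H x y d -> exists z w, [/\ x = phi z, y = phi w & P z w])
  (Prefl : forall x, P x x) (Ptrans : forall x y z, P x y -> P y z -> P x z).

Notation node := (seq (bool * nat)).

Definition node_bits (s : node) (i : nat) : bool := (nth (false, 0%N) s i).1.
Definition node_nats (s : node) (i : nat) : nat := (nth (false, 0%N) s i).2.

Definition tree (z : X) (s : node) : Prop :=
  chain_approx H (size s) (node_bits s) (phi z) (node_nats s).

Definition tree_indices (z : X) (n : nat) : bool := `[< tree z (node_of n) >].

(** The root is in every tree and carries infinitely many indices. *)
Lemma tree_indices_inf z : inf_subset_nat (tree_indices z).
Proof.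
move=> n.
have pI : injective (fun m : nat => pickle (([::] : node), m)).
  by move=> a b /(pcan_inj (@pickleK _))[].
have [m mP] := injective_unbounded n pI.
exists (pickle (([::] : node), m)); split; first exact: mP.
by apply/asboolP; rewrite node_of_pickle; exists 0%N; split.
Qed.

(** Membership of a fixed node of length [k] depends only on the first [k] bits of [phi z]. *)
Lemma tree_indices_measurable n : MX (fun z => tree_indices z n).
Proof.
set s := node_of n.
apply: (@sigma_ext _ MX (fun z => tree z s)).
  by move=> z; split=> [tz|/asboolP//]; apply/asboolP.
apply: (@sigma_finite_dep _ MX sMX _ false phi (size s)
  (fun y => chain_approx H (size s) (node_bits s) y (node_nats s))) => //.
move=> x y xy [m ch]; exists m; exact: chain_agree ch.
Qed.

(** * A witness relating [z] to [w] shifts the tree of [z] into the tree of [w] *)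

Section ShiftMap.
Variables (z w : X) (d : nat -> nat).
Hypothesis Hd : H (phi z) (phi w) d.

(** Adds what a one-step chain with witness [d] contributes to the sum, and fixes the bits, hence
    the exponent. *)
Definition shift_node (s : node) : node :=
  mkseq (fun i => (node_bits s i, node_nats s i + (d i).+1)%N) (size s).

Lemma size_shift_node s : size (shift_node s) = size s.
Proof. exact: size_mkseq. Qed.

Lemma shift_node_take s k : shift_node (take k s) = take k (shift_node s).
Proof.
apply: (@eq_from_nth _ (false, 0%N)).
  by rewrite size_shift_node !size_take_min size_shift_node.
move=> i; rewrite size_shift_node size_take_min leq_min => /andP[ik is_].
rewrite nth_mkseq ?size_take_min ?leq_min ?ik// nth_take// nth_mkseq//.
by rewrite /node_bits /node_nats nth_take.
Qed.

Lemma shift_node_inj : injective shift_node.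
Proof.
move=> s t st; have sst : size s = size t by rewrite -size_shift_node st size_shift_node.
apply: (@eq_from_nth _ (false, 0%N)) => // i ilt.
have := congr1 (fun u => nth (false, 0%N) u i) st.
rewrite !nth_mkseq -?sst// /node_bits /node_nats.
by case: (nth _ s i) => a b; case: (nth _ t i) => a' b' /= [-> /addIn ->].
Qed.

Lemma shift_node_prefix s t : prefix (shift_node s) (shift_node t) = prefix s t.
Proof.
by rewrite !prefixE size_shift_node -shift_node_take (inj_eq shift_node_inj).
Qed.

Lemma shift_node_exponent s : node_exponent R (shift_node s) = node_exponent R s.
Proof.
rewrite /node_exponent; congr ((pickle _).+2%:R^-1).
rewrite /unzip1 /shift_node /mkseq -map_comp.
apply: (@eq_from_nth _ false); first by rewrite !size_map size_iota.
move=> i; rewrite size_map size_iota => ilt.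
rewrite (nth_map 0%N) ?size_iota// nth_iota// (nth_map (false, 0%N))//.
Qed.

(** The new multiplicity is the whole index [n], which makes the map injective even where [node_of]
    falls back to its default. *)
Definition shift_index (n : nat) : nat := pickle (shift_node (node_of n), n).

Lemma shift_index_node n : node_of (shift_index n) = shift_node (node_of n).
Proof. exact: node_of_pickle. Qed.

Lemma shift_index_inj : injective shift_index.
Proof. by move=> a b /(pcan_inj (@pickleK _))[]. Qed.

Lemma tree_shift s : tree z s -> tree w (shift_node s).
Proof.
move=> [m ch].
have c1 : chain H 1 (size s) (phi z) (phi w) (fun i => (d i).+1).
  by exists (phi z), (fun=> 0%N), (phi z), (phi w), d; split.
exists (1 + m)%N; rewrite size_shift_node; apply: chain_agree (chain_trans ch c1) => //.
- by move=> i ilt; rewrite [RHS]/node_bits nth_mkseq.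
- by move=> i ilt; rewrite [RHS]/node_nats nth_mkseq.
Qed.

Lemma shift_perm_equiv_sub :
  perm_equiv_sub (node_basis R \o enum_inc (tree_indices z))
                 (node_basis R \o enum_inc (tree_indices w)).
Proof.
have iz := tree_indices_inf z; have iw := tree_indices_inf w.
have /choice[p pP] : forall i, exists j,
    enum_inc (tree_indices w) j = shift_index (enum_inc (tree_indices z) i).
  move=> i; apply: (enum_inc_surj iw); apply/asboolP; rewrite shift_index_node.
  by apply: tree_shift; apply/asboolP; exact: (enum_inc_mem iz i).
exists p; split.
  by move=> a b ab; apply/(enum_inc_inj iz)/shift_index_inj; rewrite -!pP ab.
have -> : (node_basis R \o enum_inc (tree_indices w)) \o p =
    (node_basis R \o shift_index) \o enum_inc (tree_indices z).
  by apply/funext => i; rewrite /= pP.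
apply: seq_equiv_comp (enum_inc_inj iz) (node_basis_suppressing R)
  (suppressing_comp shift_index_inj (node_basis_suppressing R)) _.
apply: relabelling_seq_equiv.
- exact: shift_index_inj.
- by move=> i j; rewrite !shift_index_node (inj_eq shift_node_inj).
- by move=> i j; rewrite !shift_index_node /comparable_nodes !shift_node_prefix.
- by move=> i; rewrite shift_index_node shift_node_exponent.
Qed.

End ShiftMap.

Definition zero_branch (x : nat -> bool) (k : nat) : node := mkseq (fun i => (x i, 0%N)) k.

Lemma tree_zero_branch z k : tree z (zero_branch (phi z) k).
Proof.
by exists 0%N; rewrite size_mkseq; split=> i ik;
  rewrite /node_bits /node_nats nth_mkseq.
Qed.

Lemma comparable_nth (s t : node) i : comparable_nodes s t ->
  (i < size s)%N -> (i < size t)%N -> nth (false, 0%N) s i = nth (false, 0%N) t i.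
Proof.
move=> /orP[/prefixP[u ->]|/prefixP[u ->]] si ti; by rewrite nth_cat ?si ?ti.
Qed.

(** Vectors over the zero branch of [z] are found whose images keep their labels; thinning puts
    these images on one branch of the tree of [w], and its second coordinates form the sequence that
    [chain_approx_limit] asks for. *)
Lemma perm_equiv_sub_reflects z w :
  perm_equiv_sub (node_basis R \o enum_inc (tree_indices z))
                 (node_basis R \o enum_inc (tree_indices w)) -> P z w.
Proof.
have iz := tree_indices_inf z; have iw := tree_indices_inf w.
move=> [p [pI eqv]].
pose g := enum_inc (tree_indices z); pose h := enum_inc (tree_indices w) \o p.
have gI : injective g by exact: enum_inc_inj.
have hI : injective h by exact: inj_comp (enum_inc_inj iw) pI.
have sb := node_basis_suppressing R.
have nb i : node_basis R i != 0 by exact: (basic_seq_neq0 (node_basis_uncond_basic R)).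
have [C0 [dgh dhg]] : exists C : nat, dominated (node_basis R \o g) (node_basis R \o h) C%:R /\
    dominated (node_basis R \o h) (node_basis R \o g) C%:R.
  by apply/(seq_equivP (suppressing_comp gI sb) (suppressing_comp hI sb)
    (fun i => nb (g i)) (fun i => nb (h i))).
pose C : R := C0.+1%:R.
have C_gt0 : 0 < C by rewrite ltr0n.
have domS (x y : nat -> linf R (functional (@chain_functional R))) :
    dominated x y C0%:R -> dominated x y C.
  by move=> dxy a n; apply: (le_trans (dxy a n)); rewrite ler_wpM2r// ler_nat.
have {}dgh := domS _ _ dgh; have {}dhg := domS _ _ dhg.
have hw i : tree w (node_of (h i)).
  by apply/asboolP; exact: (enum_inc_mem iw).
(* All the vectors at the zero node of length [k] are considered at once; [equivalent_node_labels]
   finds one whose image has the same bits. *)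
have /choice[b bP] : forall k, exists i, node_of (g i) = zero_branch (phi z) k /\
    unzip1 (node_of (h i)) = unzip1 (zero_branch (phi z) k).
  move=> k; pose s := zero_branch (phi z) k.
  have /choice[a aP] : forall j : nat, exists i, g i = pickle (s, j).
    move=> j; apply: (enum_inc_surj iz); apply/asboolP; rewrite node_of_pickle.
    exact: tree_zero_branch.
  have aI : injective a.
    by move=> i j ij; have := aP i; rewrite ij aP => /(pcan_inj (@pickleK _))[].
  have [|||i hi] := @equivalent_node_labels R (g \o a) (h \o a) C _ _ C_gt0
      (dominated_comp aI dgh) (dominated_comp aI dhg) s _.
  - exact: inj_comp.
  - exact: inj_comp.
  - by move=> i; rewrite /= aP node_of_pickle.
  by exists (a i); split=> //; rewrite aP node_of_pickle.
have gb k : node_of (g (b k)) = zero_branch (phi z) k by case: (bP k).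
have hb k : unzip1 (node_of (h (b k))) = mkseq (phi z) k.
  by have [_ ->] := bP k; rewrite /unzip1 /zero_branch /mkseq -map_comp.
have hs k : size (node_of (h (b k))) = k.
  by rewrite -(size_map fst) -/(unzip1 _) hb size_mkseq.
have bI : injective b.
  by move=> i j ij; rewrite -(hs i) ij hs.
have [||i j ij|i j ij|r [ri rP]] := @equivalent_node_chain R (g \o b) (h \o b) C _ _ C_gt0
    (dominated_comp bI dgh) _ _.
- exact: inj_comp.
- exact: inj_comp.
- rewrite /= !gb; split.
    apply/eqP => /(congr1 size); rewrite !size_mkseq => ij'.
    by rewrite ij' ltnn in ij.
  apply/orP; left; rewrite prefixE size_mkseq; apply/eqP.
  by rewrite /zero_branch /mkseq -map_take take_iota (minn_idPl (ltnW ij)).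
- apply/eqP => /(congr1 size); rewrite /= !hs => ij'.
  by rewrite ij' ltnn in ij.
have rge := increasing_nat_ge _ ri.
pose t k := node_of (h (b (r k))).
have st k : size (t k) = r k by rewrite hs.
(* Entry [i] is read off [t i.+1], whose length [r i.+1] exceeds [i]; by comparability it is also
   entry [i] of every [t k] with [k > i]. *)
apply: (chain_approx_limit phiI cH HP Ptrans Prefl (s := fun i => node_nats (t i.+1) i)) => k.
have [m ch] := hw (b (r k)).
exists m; rewrite -/(t k) st in ch.
apply: chain_agree (chain_le (rge k) ch) => // i ik.
  have ir : (i < r k)%N by exact: leq_trans ik (rge k).
  rewrite /node_bits -(nth_map _ false fst) ?st//.
  by rewrite -/(unzip1 _) hb nth_mkseq.
congr snd; have [->//|ne] := eqVneq k i.+1.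
apply: comparable_nth; last 2 first.
- by rewrite st (leq_trans ik).
- by rewrite st rge.
have : (i.+1 < k)%N by rewrite ltn_neqAle eq_sym ne.
by move=> /rP; rewrite /comparable_nodes orbC.
Qed.

End Reduction.

Theorem mainTheorem7 (R : realType) (U : completeNormedModType R) (u : nat -> U) :
  (* (u_n) is a universal unconditional basic sequence (Pelczynski) *)
  uncond_basic_seq u ->
  (forall (V : completeNormedModType R) (x : nat -> V),
      uncond_basic_seq x ->
      exists N : nat -> bool, inf_subset_nat N /\ seq_equiv x (subseq_at u N)) ->
  (* the relation is an analytic quasiorder on [omega]^omega ... *)
  quasiorder_on inf_subset_nat (perm_sub_rel u) /\
  analytic_set (prod_sigma BorelC BorelC) (rel_set (perm_sub_rel u)) /\
  (* ... and every analytic quasiorder on a standard Borel space Borel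
     reduces to it *)
  (forall (X : Type) (MX : set (set X)) (P : X -> X -> Prop),
      standard_borel MX ->
      quasiorder_on setT P ->
      analytic_set (prod_sigma MX MX) (rel_set P) ->
      exists f : X -> (nat -> bool),
        measurable_map MX BorelC f /\
        (forall z, inf_subset_nat (f z)) /\
        (forall z w, P z w <-> perm_sub_rel u (f z) (f w))).
Proof.
move=> ubu univ.
have [K su] := uncond_basic_suppressing ubu.
have u0 := basic_seq_neq0 ubu.
split; first exact: perm_sub_rel_quasiorder su.
split; first exact: perm_sub_rel_analytic su u0.
move=> X MX P sbX [Prefl Ptrans] aP.
have [sMX _] := sbX.
have [phi [H [phiI phiM cH PH HP]]] := analytic_closed_coding sbX aP.
have {}Prefl x : P x x by exact: Prefl.
have {}Ptrans x y z : P x y -> P y z -> P x z by exact: Ptrans.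
(* Universality realizes the node basis as the subsequence of [u] along [N], so that trees become
   subsets of [N]. *)
have [N [iN eqN]] := univ _ _ (node_basis_uncond_basic R).
pose A := tree_indices phi H.
have iA z : inf_subset_nat (A z) by exact: tree_indices_inf.
exists (fun z => enum_image N (A z)); split; [|split].
- move=> B /(_ _ (is_sigma_algebra_preimage (fun z => enum_image N (A z)) sMX)).
  apply => _ [k [b ->]] /=.
  have mk : MX (fun z => enum_image N (A z) k).
    apply: (@sigma_ext _ MX (fun z => exists i, enum_inc N i = k /\ A z i)).
      by move=> z; split=> [e|/asboolP//]; apply/asboolP.
    apply: (sigma_exists sMX) => i; apply: (sigma_and sMX).
      exact: (sigma_const sMX).
    exact: tree_indices_measurable.
  case: b => //; apply: sigma_ext (sigma_not sMX mk) => z /=.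
  by split=> [/negP/negbTE|->].
- by move=> z; exact: enum_image_inf.
move=> z w.
have sN := suppressing_comp (enum_inc_inj iN) su.
(* Stated for every injective reindexing, so that it serves both the enumeration of a tree and its
   composition with an embedding [p]. *)
have eqA (h : nat -> nat) : injective h ->
    seq_equiv (node_basis R \o h) ((u \o enum_inc N) \o h).
  by move=> hI; exact: seq_equiv_comp hI (node_basis_suppressing R) sN eqN.
have transfer : perm_equiv_sub (node_basis R \o enum_inc (A z)) (node_basis R \o enum_inc (A w)) <->
    perm_equiv_sub (subseq_at u (enum_image N (A z))) (subseq_at u (enum_image N (A w))).
  rewrite /subseq_at !enum_inc_image//.
  have ez := eqA _ (enum_inc_inj (iA z)).
  split=> -[p [pI e]]; exists p; split=> // a.
    have ew := eqA _ (inj_comp (enum_inc_inj (iA w)) pI).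
    by rewrite -(ez a) (e a); exact: (ew a).
  have ew := eqA _ (inj_comp (enum_inc_inj (iA w)) pI).
  by rewrite (ez a) (e a); apply: iff_sym; exact: (ew a).
split=> [/PH[d Hd]|[_ [_ /transfer pe]]]; last first.
  exact: (perm_equiv_sub_reflects phiI cH HP Prefl Ptrans pe).
do 2?[split; first exact: enum_image_inf].
by apply/transfer; exact: shift_perm_equiv_sub Hd.
Qed.
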